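(* Let $X$ be a connected infinite simple graph with $\Delta:=\deg X<\infty$. Then the following properties hold for any sequence $\epsilon_n\uparrow\infty$ ($n\in\mathbb{N}$) in $\mathbb{Z}^+$: (i) There are a sequence $\delta_n$ in $\mathbb{Z}^+$, with every $\delta_n$ depending only on $\Delta$, $\epsilon_m$ for $m\le n$, and $\delta_m$ for $m<n$; and a sequence of colorings $\phi^N$ ($N\in\mathbb{N}$) of $X$ by $\Delta$ colors, with every $\phi^N$ depending on $\epsilon_m$ for $m\le N$; such that, for all $x,y\in X$, $N\in\mathbb{N}$ and $0\le n\le N$, $$0<d(x,y)<\epsilon_n\ \Longrightarrow\ [D(x,\delta_n),x,\phi^N]\ne[D(y,\delta_n),y,\phi^N].$$ (ii) Suppose that, for some $p\in X$ and some sequences $\mathfrak{r}_n\uparrow\infty$ and $\omega_n$ in $\mathbb{Z}^+$, with every $\mathfrak{r}_n$ large enough depending on $\Delta$ and $\epsilon_m$ for $m\le n$, the sets $$\Omega_n=\{x\in X : [D(x,\mathfrak{r}_n),x,d_X]=[D(p,\mathfrak{r}_n),p,d_X]\}$$ are $\omega_n$-relatively dense in $X$. Then there are: - a sequence $r_n\uparrow\infty$ in $\mathbb{Z}^+$, with every $r_n$ depending on $\Delta$, $\epsilon_m$ and $\omega_m$ for $m\le n$, and $r_m$ for $m<n$; - a sequence $\alpha_n$ in $\mathbb{Z}^+$, with every $\alpha_n$ depending on $\Delta$, $\epsilon_m$ and $\omega_m$ for $m\le n$, and $r_m$ and $\alpha_m$ for $m<n$; and - a sequence of colorings $\phi^N$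 of $X$ by $\Delta$ colors, with every $\phi^N$ depending on $\epsilon_m$ and $\mathfrak{r}_m$ for $m\le N$; such that the colorings $\phi^N$ satisfy (i) with some sequence $\delta_n$, and the sets $$\widehat\Omega_n=\Big\{x\in X : \big[D\big(x,\textstyle\sum_{i=0}^n r_i\big),x,\phi^N\big]=\big[D\big(p,\textstyle\sum_{i=0}^n r_i\big),p,\phi^N\big]\Big\}$$ are $\alpha_n$-relatively dense in $X$ for $0\le n\le N$.
   Context: Graphs are undirected, countable, with finite vertex degrees; simple means no loops and at most one edge between two vertices. $\deg X$ is the supremum of the vertex degrees. A connected graph $X$ (identified with its vertex set) has the metric $d=d_X$ given by minimal path length. $D(x,r)=\{y\in X:d(x,y)\le r\}$, regarded as an induced subgraph. A coloring by $\Delta$ colors is a map $\phi:X\to\{0,\dots,\Delta-1\}$. $[D(x,r),x,\phi]$ denotes the isomorphism class of the pointed colored graph $D(x,r)$ with base point $x$ and coloring $\phi|_{D(x,r)}$ (isomorphisms are graph isomorphisms preserving base points and colors). $[D(x,r),x,d_X]$ denotes the isometry class of the pointed metric space $D(x,r)$, with base point $x$ and the restriction of $d_X$ as metric. A subset $Q\subset X$ is $C$-relatively dense if every point of $X$ is at distance at most $C$ from $Q$. The dependence clauses mean that the numbers $\delta_n$, $r_n$, $\alpha_n$ can be chosen as functions of the listed data only (in particular they are independent of the choice of $X$ satisfying the hypotheses), while the colorings $\phi^N$ are constructed on the given $X$ using only the listed terms of the sequences. ''$\mathfrak{r}_n$ large enough depending on $\Delta$ and $\epsilon_m$ for $m\le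 n$'' means that $\mathfrak{r}_n$ exceeds some threshold which is a function of $\Delta,\epsilon_0,\dots,\epsilon_n$ only. *)

(* Defs.v *)
From mathcomp Require Import all_boot all_order.
From mathcomp Require Import boolp classical_sets functions cardinality filter.
From mathcomp Require Import finmap.

Set Implicit Arguments.
Unset Strict Implicit.
Unset Printing Implicit Defensive.

Local Open Scope classical_set_scope.

Section Graph.
Variables (X : countType) (e : rel X).

Definition walk (x y : X) (n : nat) : Prop :=
  exists s : seq X, [/\ path e x s, last x s = y & size s = n].

Definition connected_graph : Prop := forall x y, exists n, walk x y n.

(* Total function: the value 0 given to a pair of vertices joined by no walk
   is never used, since all graphs considered are connected. *)
Definition gdist (x y : X) : nat :=
  if pselect (exists n, `[< walk x y n >]) is left h then ex_minn h else 0.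

Definition gball (x : X) (r : nat) : set X := [set y | gdist x y <= r].

Definition neighbors (x : X) : set X := [set y | e x y].

(* [fset_set] is only meaningful on finite sets; [degree_of_graph] requires
   all neighborhoods to be finite. *)
Definition vdegree (x : X) : nat := #|` fset_set (neighbors x)|.

Definition degree_of_graph (Delta : nat) : Prop :=
  (forall x, finite_set (neighbors x)) /\ isLub (range vdegree) Delta.

Definition infinite_simple_graph (Delta : nat) : Prop :=
  [/\ symmetric e, irreflexive e, connected_graph, infinite_set [set: X]
    & degree_of_graph Delta].

(* [D(x,r), x, phi] = [D(y,r), y, phi] *)
Definition same_colored_ball (C : Type) (r : nat) (phi : X -> C) (x y : X) :
    Prop :=
  exists f : X -> X,
    [/\ set_bij (gball x r) (gball y r) f,
        f x = y,
        forall u v, gball x r u -> gball x r v -> e (f u) (f v) = e u v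
      & forall u, gball x r u -> phi (f u) = phi u].

(* [D(x,r), x, d_X] = [D(y,r), y, d_X] *)
Definition same_metric_ball (r : nat) (x y : X) : Prop :=
  exists f : X -> X,
    [/\ set_bij (gball x r) (gball y r) f,
        f x = y
      & forall u v, gball x r u -> gball x r v ->
          gdist (f u) (f v) = gdist u v].

Definition relatively_dense (C : nat) (Q : set X) : Prop :=
  forall x, exists2 q, Q q & gdist x q <= C.

Definition distinguishes (eps delta : nat -> nat) (C : Type)
    (phi : nat -> X -> C) : Prop :=
  forall (x y : X) (N n : nat), n <= N ->
    0 < gdist x y < eps n -> ~ same_colored_ball (delta n) (phi N) x y.

End Graph.

Definition positive_seq (u : nat -> nat) : Prop := forall n, 0 < u n.

(* u_n increases to infinity; the monotonicity is not strict. *)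
Definition increases_to_infinity (u : nat -> nat) : Prop :=
  {homo u : m n / m <= n} /\ u @ \oo --> \oo.

(* The finite sequences u_0, ..., u_n and u_0, ..., u_(n-1).  A quantity
   depending only on such terms is expressed as a function of these lists. *)
Definition upto (u : nat -> nat) (n : nat) : seq nat := mkseq u n.+1.
Definition below (u : nat -> nat) (n : nat) : seq nat := mkseq u n.

(* Main.v *)
Require Import Defs.
From mathcomp Require Import all_boot all_order finmap zify.
From mathcomp Require Import boolp classical_sets functions cardinality filter.

Set Implicit Arguments.
Unset Strict Implicit.
Unset Printing Implicit Defensive.

Local Open Scope classical_set_scope.

(** Landmarks, called roots, are placed at infinitely many scales, and a coloring is
built that makes them recognizable.  At level 0 every vertex has a rank, essentially
its distance to the nearest root; a vertex that is not a root is attached to a parent,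
a neighbor of smaller rank, and siblings get distinct nonzero colors.  This takes
Delta - 1 colors, since a vertex with a parent has at most Delta - 1 children.  The
color 0 marks the roots: it is given to a root c, to one neighbor of c (so that at most
Delta - 1 children of c remain to be colored), to a third vertex that tells c from this
neighbor, and to isolated vertices that serve as bits.  By induction on the rank, a
colored isomorphism between balls that fixes the roots near x fixes x
([siblings_rigid], [base_prelevel]).  The bits around each root spell a code, chosen
such that roots at bounded distance from each other never have isomorphic surroundings
([code_exists]): an isomorphism that moves x by less than eps_0 maps a root near x to
a root at bounded distance from it, hence to itself, and so it fixes x.  Around each
root some bits are left free; they can be read off the coloring ([symbolE]) and are
the carriers on which the next level writes the same kind of code for eps_1, with roots
chosen among those of level 0, and so on ([levels]).  Whatever the higher levels
write, the balls of a radius that depends only on the levels up to n separate points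
at distance less than eps_n.

A root needs more codes than it has competitors.  If it can use w carriers, it has 2^w
codes, but its ball may look like a path, with w linear in the radius rho, while there
are exponentially many competitors a little farther away.  So a root is called fat if
its ball has at least W points, and thin otherwise.  Fat roots come first, and thin roots
are placed only far from them ([net_exists]).  Fat roots compete with each other
up to a distance that is linear in rho, and W is chosen, also linear in rho, such that 2^w
exceeds the size of a ball of that radius.  Thin roots compete with each other up to a
smaller distance, within which all balls are thin, so that they have at most W^30
competitors, and 2^w is larger if rho is large ([code_available],
[numbers_exist]).

For part (ii), sites are chosen: sets Q_m of points q with isometries from D(p, t_m)
onto D(q, t_m), such that two sites are either far apart or nested, and such that the
chart of a site carries the smaller sites inside D(p, R_m) to the smaller sites inside
D(q, R_m) ([sites_exist]).  All choices of the construction are made greedily, along an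
order that the charts preserve ([key_exists], [greedy]), so they are copied by the charts of
the sites of level m as long as the choice belongs to a level at most m; the higher
levels leave these sites blank.  Hence the coloring near q is a copy of the coloring
near p.  The sites of level n are relatively dense although they must not cross the
boundaries of larger sites: a point near such a boundary is moved inwards, where only
boundaries of sites of bounded level can interfere ([sites_dense]).  The sequences r_n
and the threshold for the given radii are computed from Delta and eps_0, ..., eps_n alone;
only alpha_n uses omega_n. *)

(** * Distances and balls *)

Section Metric.
Variables (X : countType) (e : rel X).
Hypotheses (sym : symmetric e) (irr : irreflexive e) (con : connected_graph e).
Local Notation d := (gdist e).

Lemma gdist_walk x y : walk e x y (d x y).
Proof.
rewrite /gdist; case: pselect => [h|h]; first by case: ex_minnP => n /asboolP.
by case: h; have [n ?] := con x y; exists n; apply/asboolP.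
Qed.

Lemma gdist_le x y n : walk e x y n -> d x y <= n.
Proof.
move=> w; rewrite /gdist; case: pselect => [h|h] //.
by case: ex_minnP => m _; apply; apply/asboolP.
Qed.

Lemma gdistxx x : d x x = 0.
Proof. by apply/eqP; rewrite -leqn0; apply: gdist_le; exists [::]. Qed.

Lemma gdist0 x y : d x y = 0 -> x = y.
Proof. by move=> h; have := gdist_walk x y; rewrite h => -[[|a s] [_ <-]]. Qed.

Lemma walk_cat x y z m n : walk e x y m -> walk e y z n -> walk e x z (m + n).
Proof.
move=> [s [ps ls <-]] [s' [ps' ls' <-]]; exists (s ++ s').
by rewrite cat_path last_cat size_cat ls ps.
Qed.

Lemma walk_sym x y n : walk e x y n -> walk e y x n.
Proof.
move=> [s [ps ls <-]]; exists (rev (belast x s)); split.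
- by rewrite -ls rev_path (eq_path (e' := e)) // => a b; rewrite sym.
- by case: s ls {ps} => [|a s] /= <- //; rewrite rev_cons last_rcons.
- by rewrite size_rev size_belast.
Qed.

Lemma gdistC x y : d x y = d y x.
Proof.
by apply/eqP; rewrite eqn_leq !gdist_le //; apply/walk_sym/gdist_walk.
Qed.

Lemma gdist_tri z x y : d x y <= d x z + d z y.
Proof. by apply: gdist_le; apply: walk_cat; apply: gdist_walk. Qed.

Lemma gdist_adj x y : e x y -> d x y = 1.
Proof.
move=> xy; apply/eqP; rewrite eqn_leq gdist_le /=; last first.
  by exists [:: y] => /=; rewrite xy.
by rewrite lt0n; apply/eqP => /gdist0 xyE; move: xy; rewrite xyE irr.
Qed.

Lemma gdist1 x y : d x y = 1 -> e x y.
Proof.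
move=> h; have [s [ps ls]] := gdist_walk x y; rewrite h.
by case: s ps ls => [|a [|]] //= /andP[xa _] <-.
Qed.

Lemma adjE x y : e x y = (d x y == 1).
Proof. by apply/idP/eqP; [exact: gdist_adj | exact: gdist1]. Qed.

Lemma gdist_between x y n : n <= d x y ->
  exists2 z, d x z = n & d z y = d x y - n.
Proof.
move=> nd; have [s [ps ls sz]] := gdist_walk x y.
have ns : n <= size s by rewrite sz.
pose z := last x (take n s).
move: ps ls; rewrite -{1 2}(cat_take_drop n s) cat_path last_cat => /andP[p1 p2] l2.
have xz : d x z <= n.
  by apply: gdist_le; exists (take n s); split=> //; rewrite size_take_min; lia.
have zy : d z y <= d x y - n.
  by apply: gdist_le; exists (drop n s); split=> //; rewrite size_drop sz.
by have := gdist_tri z x y => ?; exists z; lia.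
Qed.

(** ** Growth of balls *)

Variable Delta : nat.
Hypothesis deg : degree_of_graph e Delta.
Hypothesis inf : infinite_set [set: X].

Lemma finite_gball x r : finite_set (gball e x r).
Proof.
elim: r => [|r IH].
  apply: (@sub_finite_set _ _ [set x]); last exact: finite_set1.
  by move=> y /= ; rewrite /gball /= leqn0 => /eqP /gdist0 ->.
apply: (@sub_finite_set _ _ (gball e x r `|`
   \bigcup_(y in gball e x r) neighbors e y)).
  move=> y; rewrite /gball /= => yr; have [yr'|yr'] := leqP (d x y) r; first by left.
  have [z xz zy] := @gdist_between x y r (ltnW yr').
  right; exists z => /=; first by rewrite xz.
  by apply: gdist1; lia.
rewrite finite_setU; split => //; apply: bigcup_finite => // y _.
by case: deg => h _; apply: h.
Qed.

Definition ball x r : {fset X} := fset_set (gball e x r).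

Lemma in_ball x r y : (y \in ball x r) = (d x y <= r).
Proof.
by rewrite /ball in_fset_set; [apply/asboolP/idP | exact: finite_gball].
Qed.

Lemma card_ball0 x : #|` ball x 0| = 1.
Proof.
suff -> : ball x 0 = [fset x]%fset by rewrite cardfs1.
apply/fsetP => y; rewrite in_ball inE leqn0.
by apply/eqP/eqP => [/gdist0|] ->; rewrite ?gdistxx.
Qed.

Lemma card_neighbors x : #|` fset_set (neighbors e x)| <= Delta.
Proof.
case: deg => _ [+ _]; rewrite /ubound /= => h.
by apply: (h (vdegree e x)); exists x.
Qed.


Lemma card_cover (T U : choiceType) (A : {fset T}) (I : seq U)
    (F : U -> {fset T}) a :
  (forall y, y \in A -> exists2 i, i \in I & y \in F i) ->
  (forall i, i \in I -> #|` F i| <= a) -> #|` A| <= size I * a.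
Proof.
elim: I A => [|i I IH] A cov le.
  rewrite leqn0 cardfs_eq0; apply/eqP/fsetP => y; rewrite inE.
  by apply/negP => /cov[].
rewrite mulSn -(cardfsID (F i) A); apply: leq_add.
  apply: leq_trans (le i (mem_head _ _)).
  by apply/fsubset_leq_card/fsubsetIr.
apply: IH => [y|j jI]; last by apply: le; rewrite inE jI orbT.
rewrite inE => /andP[yF /cov[j]]; rewrite inE => /orP[/eqP->|jI] yj; last by exists j.
by rewrite yj in yF.
Qed.

(** The relational form avoids choosing an injection. *)
Lemma card_inj (T U : choiceType) (A : {fset T}) (B : {fset U}) (R : T -> U -> Prop) :
  (forall x, x \in A -> exists2 y, y \in B & R x y) ->
  (forall x x' y, x \in A -> x' \in A -> R x y -> R x' y -> x = x') ->
  #|` A| <= #|` B|.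
Proof.
move=> tot inj; rewrite -[leqRHS]muln1.
have [->|/fset0Pn[x0 _]] := eqVneq A fset0; first by rewrite cardfs0.
have /choice[f fP] : forall y, exists x, forall x', x' \in A -> R x' y -> x' = x.
  move=> y; have [[x xA xy]|h] := pselect (exists2 x, x \in A & R x y).
    by exists x => x' x'A x'y; apply: (inj _ _ y).
  by exists x0 => x' x'A x'y; case: h; exists x'.
apply: (card_cover (F := fun y => [fset f y]%fset)) => [x xA|y _].
  by have [y yB xy] := tot x xA; exists y => //; rewrite inE (fP y x xA xy).
by rewrite cardfs1.
Qed.
Lemma card_ball_cover x r a b : (forall y, d x y <= r -> #|` ball y a| <= b) ->
  #|` ball x (r + a)| <= #|` ball x r| * b.
Proof.
move=> le; apply: (card_cover (F := fun y => ball y a)) => [y|y]; last first.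
  by rewrite in_ball; apply: le.
rewrite in_ball => xy; have [yr|yr] := leqP (d x y) r.
  by exists y; rewrite in_ball ?gdistxx.
have [z xz zy] := @gdist_between x y r (ltnW yr).
by exists z; rewrite in_ball; lia.
Qed.

Lemma card_ball_le x r : #|` ball x r| <= Delta.+1 ^ r.
Proof.
elim: r => [|r IH]; first by rewrite card_ball0.
rewrite -addn1 expnD expn1; apply: leq_trans (leq_mul IH (leqnn _)).
apply: card_ball_cover => y _.
have sub : (ball y 1 `<=` [fset y] `|` fset_set (neighbors e y))%fset; last first.
  apply: leq_trans (fsubset_leq_card sub) _.
  have [le _] := leq_card_fsetU [fset y]%fset (fset_set (neighbors e y)).
  by apply: leq_trans le _; rewrite cardfs1 add1n ltnS card_neighbors.
apply/fsubsetP => z; rewrite in_ball inE.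
have [yz _|] := boolP (d y z == 0); first by rewrite (gdist0 (eqP yz)) inE eqxx.
move=> n0 n1; have /gdist1 yz : d y z = 1 by lia.
apply/orP; right; rewrite in_fset_set; last by case: deg => h _; apply: h.
exact: mem_set.
Qed.

Lemma gdist_surj x n : exists y, d x y = n.
Proof.
have [[y ny]|h] := pselect (exists y, n <= d x y).
  by have [z <- _] := gdist_between ny; exists z.
case: inf; apply: sub_finite_set (finite_gball x n) => y _.
by rewrite /gball /=; case: leqP => // /ltnW ny; case: h; exists y.
Qed.

Lemma card_ball_ge x r : r < #|` ball x r|.
Proof.
elim: r => [|r IH]; first by rewrite card_ball0.
have [y xy] := gdist_surj x r.+1.
apply: leq_ltn_trans IH _; apply: fproper_ltn_card.
rewrite fproperE; apply/andP; split.
  by apply/fsubsetP => z; rewrite !in_ball; lia.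
by apply/fsubsetPn; exists y; rewrite in_ball xy ?ltnn.
Qed.
End Metric.

(** * Local isometries *)

Section Liso.
Variables (X : countType) (e : rel X).
Hypotheses (sym : symmetric e) (irr : irreflexive e) (con : connected_graph e).
Local Notation d := (gdist e).

Definition liso r x y (f : X -> X) :=
  [/\ f x = y,
      forall u v, d x u <= r -> d x v <= r -> d (f u) (f v) = d u v
    & forall v, d y v <= r -> exists2 u, d x u <= r & f u = v].

Definition ciso (C : Type) r x y f (phi psi : X -> C) :=
  liso r x y f /\ forall u, d x u <= r -> psi (f u) = phi u.

Lemma liso_dist r x y f u : liso r x y f -> d x u <= r -> d y (f u) = d x u.
Proof. by move=> [<- dE _] xu; apply: dE; rewrite ?gdistxx. Qed.

Lemma liso_adj r x y f u v : liso r x y f -> d x u <= r -> d x v <= r ->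
  e (f u) (f v) = e u v.
Proof. by move=> [_ dE _] xu xv; rewrite !(adjE irr con) dE. Qed.

Lemma liso_id r x : liso r x x id.
Proof. by split=> // v ?; exists v. Qed.

Lemma liso_restr r x y f u r' : liso r x y f -> d x u + r' <= r ->
  liso r' u (f u) f.
Proof.
move=> L le; have [fx dE su] := L.
have T w : d u w <= r' -> d x w <= r.
  by move=> uw; have := gdist_tri con u x w; lia.
split=> // [v w uv uw|v uv]; first by apply: dE; apply: T.
have yu := @liso_dist _ _ _ _ _ L (ltac:(lia) : d x u <= r).
have [|w xw wv] := su v; first by have := gdist_tri con (f u) y v; lia.
by exists w => //; rewrite -dE ?wv //; lia.
Qed.

Lemma liso_le r r' x y f : liso r x y f -> r' <= r -> liso r' x y f.
Proof.
by move=> L le; have [fx _ _] := L; rewrite -{1}fx; apply: liso_restr L _; rewrite gdistxx.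
Qed.

Lemma liso_comp r x y z f g : liso r x y f -> liso r y z g -> liso r x z (g \o f).
Proof.
move=> L L'; have [fx dE su] := L; have [gy dE' su'] := L'; split=> [|u v xu xv|v zv].
- by rewrite /= fx.
- by rewrite /= dE' ?dE ?(liso_dist L).
- by have [w /su[u xu <-] <-] := su' v zv; exists u.
Qed.

Lemma liso_inj r x y f u v : liso r x y f -> d x u <= r -> d x v <= r ->
  f u = f v -> u = v.
Proof.
move=> [_ dE _] xu xv fuv; apply: (gdist0 con).
by rewrite -dE // fuv gdistxx.
Qed.

Lemma liso_inv r x y f : liso r x y f -> exists g,
  [/\ liso r y x g, forall u, d x u <= r -> g (f u) = u
    & forall v, d y v <= r -> f (g v) = v /\ d x (g v) <= r].
Proof.
move=> L; have [fx dE su] := L.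
have /choice[g gP] : forall v, exists u, d y v <= r -> d x u <= r /\ f u = v.
  move=> v; have [/su[u]|] := boolP (d y v <= r); first by exists u.
  by exists x.
have gf u : d x u <= r -> g (f u) = u.
  move=> xu; have [|xg fg] := gP (f u); first by rewrite (liso_dist L).
  exact: (liso_inj L).
exists g; split=> // [|v yv]; last by have [] := gP v yv.
split=> [|u v yu yv|u xu].
- by rewrite -fx gf ?gdistxx.
- have [xu fu] := gP u yu; have [xv fv] := gP v yv.
  by rewrite -dE // fu fv.
- by exists (f u); rewrite ?gf ?(liso_dist L).
Qed.

Lemma ciso_restr (C : Type) r x y f (phi psi : X -> C) u r' :
  ciso r x y f phi psi -> d x u + r' <= r -> ciso r' u (f u) f phi psi.
Proof.
move=> [L co] le; split=> [|v uv]; first exact: liso_restr L le.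
by apply: co; have := gdist_tri con u x v; lia.
Qed.

Lemma ciso_le (C : Type) r x y f (phi psi : X -> C) r' :
  ciso r x y f phi psi -> r' <= r -> ciso r' x y f phi psi.
Proof. by move=> [L co] le; split=> [|v uv]; [exact: liso_le L le|apply: co; lia]. Qed.

Lemma ciso_comp (C : Type) r x y z f g (phi psi chi : X -> C) :
  ciso r x y f phi psi -> ciso r y z g psi chi -> ciso r x z (g \o f) phi chi.
Proof.
move=> [L co] [L' co']; split=> [|u xu]; first exact: liso_comp L'.
by rewrite /= co' ?co ?(liso_dist L).
Qed.

Lemma ciso_inv (C : Type) r x y f (phi psi : X -> C) : ciso r x y f phi psi ->
  exists g, [/\ ciso r y x g psi phi, forall u, d x u <= r -> g (f u) = u
    & forall v, d y v <= r -> f (g v) = v /\ d x (g v) <= r].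
Proof.
move=> [L co]; have [g [L' gf fg]] := liso_inv L; exists g; split=> //.
by split=> // v yv; have [fv xg] := fg v yv; rewrite -[in RHS]fv co.
Qed.

(** A geodesic between two points of D(x, r) has length at most 2r, so it stays inside
D(x, 3r), where the isomorphism and its inverse preserve adjacency. *)
Lemma same_ball_ciso (C : Type) r (phi : X -> C) x y :
  same_colored_ball e (3 * r) phi x y -> exists f, ciso r x y f phi phi.
Proof.
move=> [f [bij fx ed co]].
have su v : d y v <= 3 * r -> exists2 u, d x u <= 3 * r & f u = v.
  by case: bij => _ _ su yv; have [u] := su v yv; exists u.
have inB u : d x u <= 3 * r -> d y (f u) <= 3 * r.
  by case: bij => fu _ _; apply: fu.
have inj u v : d x u <= 3 * r -> d x v <= 3 * r -> f u = f v -> u = v.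
  by case: bij => _ inj _ xu xv; apply: inj; rewrite inE.
(* f does not increase distances up to 2r, as geodesics stay inside D(x, 3r) *)
have short n u v : d u v = n -> d x u + n <= 3 * r -> d (f u) (f v) <= n.
  elim: n u v => [|n IH] u v uv xu; first by rewrite (gdist0 con uv) gdistxx.
  have [w uw wv] := @gdist_between _ _ con u v 1 ltac:(lia).
  have xw : d x w <= d x u + 1 by rewrite -uw; apply: gdist_tri.
  have fuw : d (f u) (f w) = 1.
    by apply: gdist_adj => //; rewrite ed /gball /=; [apply: gdist1|lia|lia].
  have := IH w v ltac:(lia) ltac:(lia).
  by have := gdist_tri con (f w) (f u) (f v); lia.
have short' n u v : d x u <= 3 * r -> d x v <= 3 * r ->
    d (f u) (f v) = n -> d y (f u) + n <= 3 * r -> d u v <= n.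
  elim: n u v => [|n IH] u v xu xv uv yu.
    by rewrite (inj u v) ?gdistxx //; apply: (gdist0 con).
  have [w uw wv] := @gdist_between _ _ con (f u) (f v) 1 ltac:(lia).
  have yw : d y w <= d y (f u) + 1 by rewrite -uw; apply: gdist_tri.
  have [w' xw' w'w] := su w ltac:(lia).
  have e1 : d u w' = 1.
    by apply: gdist_adj => //; rewrite -ed // w'w; apply: gdist1.
  have := IH w' v xw' xv; rewrite w'w => /(_ ltac:(lia) ltac:(lia)).
  by have := gdist_tri con w' u v; lia.

have Lf u : d x u <= 3 * r -> d y (f u) <= d x u.
  by move=> xu; rewrite -fx; apply: (short _ _ _ erefl); rewrite gdistxx; lia.
have Lf' u : d x u <= 3 * r -> d x u <= d y (f u).
  move=> xu; apply: (short' _ x u _ _ _ _); rewrite ?gdistxx ?fx //.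
  by rewrite gdistxx; apply: inB.
exists f; split; last by move=> u xu; apply: co; rewrite /gball /=; lia.
split=> // [u v xu xv|v yv].
  have := gdist_tri con x u v; rewrite (gdistC sym con u x) => uv.
  have le1 : d (f u) (f v) <= d u v by apply: short; lia.
  apply/eqP; rewrite eqn_leq le1 /=; apply: short'; rewrite ?erefl //; try lia.
  by have := Lf u ltac:(lia); lia.
have [u xu uv] := su v ltac:(lia); exists u => //.
by rewrite -uv in yv; have := Lf' u xu; lia.
Qed.
End Liso.

(** * Nested sites and greedy choices *)

Definition least (P : nat -> Prop) : nat :=
  if pselect (exists n, `[< P n >]) is left h then ex_minn h else 0.

Lemma leastP (P : nat -> Prop) : (exists n, P n) -> P (least P).
Proof.
move=> [n Pn]; rewrite /least; case: pselect => [h|[]].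
  by case: ex_minnP => m /asboolP.
by exists n; apply/asboolP.
Qed.

Lemma least_min (P : nat -> Prop) n : P n -> least P <= n.
Proof.
move=> Pn; rewrite /least; case: pselect => // h.
by case: ex_minnP => m _; apply; apply/asboolP.
Qed.

Lemma eq_least (P P' : nat -> Prop) : (forall n, P n <-> P' n) -> least P = least P'.
Proof. by move=> PP'; congr least; apply/funext => n; apply/propext. Qed.

Section Sites.
Variables (X : countType) (e : rel X).
Hypotheses (sym : symmetric e) (con : connected_graph e).
Local Notation d := (gdist e).
Local Notation tri := (gdist_tri con).
Local Notation dC := (gdistC sym con).
Local Notation dxx := (gdistxx e).
Variables (N : nat) (R S t : nat -> nat) (p : X).

(** A site of level m is a point q with a chart [h m q] from D(p, t m) onto D(q, t m);
the part of the chart that is copied is D(p, R m).  Two sites are far from each other or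
nested, with a margin [S] that is governed by the smaller one. The sites inside a site,
with their charts, are the copies of the sites inside D(p, R m). *)
Record sites (Q : nat -> X -> Prop) (h : nat -> X -> X -> X) : Prop := Sites {
  sites_root : forall m q, Q m q -> m <= N /\ Q m p;
  sites_dich : forall m m' q q', m' <= m -> Q m q -> Q m' q' ->
    [\/ m = m' /\ q = q', R m + R m' + S m' < d q q'
      | m' < m /\ d q q' + R m' + S m' <= R m];
  sites_chart : forall m q, Q m q -> liso e (t m) p q (h m q);
  sites_coh : forall m m' q u, m' < m -> Q m q ->
    d p u + R m' + S m' <= R m -> (Q m' u <-> Q m' (h m q u));
  sites_comp : forall m m' q u z, m' < m -> Q m q ->
    d p u + R m' + S m' <= R m -> Q m' u -> d p z <= R m' ->
    h m' (h m q u) z = h m q (h m' u z);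
  sites_id : forall m z, Q m p -> d p z <= t m -> h m p z = z
}.

Variables (Q : nat -> X -> Prop) (h : nat -> X -> X -> X).
Hypothesis st : sites Q h.
Hypothesis Rt : forall m, R m <= t m.

(** Invariance under the charts of level at least k, on the ball of radius R m - a.  The
margin a absorbs the radius of the local rules from which F is computed. *)
Definition invd k a (T : Type) (F : X -> T) :=
  forall m q x, k <= m -> Q m q -> d p x + a <= R m -> F (h m q x) = F x.

Lemma invd_le k k' a a' (T : Type) (F : X -> T) :
  invd k a F -> k <= k' -> a <= a' -> invd k' a' F.
Proof. by move=> i kk aa m q x km Qq px; apply: i => //; lia. Qed.

Lemma chart_restr m q x r : Q m q -> d p x + r <= t m ->
  liso e r x (h m q x) (h m q).
Proof. by move=> /(sites_chart st) L le; apply: liso_restr L le. Qed.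

(** ** An order preserved by the charts *)

(** The stage of x is the level of the smallest site of level at least k containing x (or
N + 1), and its representative is the point of D(p, R) from which the chart of this site
brings x.  Stages and representatives are preserved by charts, by coherence of the
charts of nested sites.  A point whose stage is at most that of x, and which is close to
x, belongs to the smallest site of x: so only points of one chart matter for a choice that
is made at x after the choices at smaller keys. *)
Section Key.
Variables (k a G : nat).
Hypothesis GS : forall m, k <= m -> m <= N -> G <= S m.

Let inS m q x := [/\ k <= m, Q m q & d q x + a <= R m].
Let stage x := least (fun m => m = N.+1 \/ exists q, inS m q x).

Let stageP x : stage x = N.+1 \/ exists q, inS (stage x) q x.
Proof. by apply: (@leastP (fun m => m = N.+1 \/ exists q, inS m q x)); exists N.+1; left. Qed.

Let stage_le m q x : inS m q x -> stage x <= m.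
Proof. by move=> i; apply: least_min; right; exists q. Qed.

Let inS_N m q x : inS m q x -> m <= N.
Proof. by move=> [_ /(sites_root st)[]]. Qed.

Let nest m q x m' q' y : inS m q x -> inS m' q' y -> m' <= m -> d x y <= G ->
  (m = m' /\ q = q') \/ (m' < m /\ d q q' + R m' + S m' <= R m).
Proof.
move=> i i' le xy; have mN := inS_N i'; have [km Qq qx] := i; have [km' Qq' qx'] := i'.
have [||]:= sites_dich st le Qq Qq'; [by left| |by right].
have := tri x q q'; have := tri y x q'; rewrite (dC y q').
by have := GS km' mN; lia.
Qed.

Let inS_trans m q x m' q' x' y : inS m q x -> inS m' q' x' -> m' <= m -> d x x' <= G ->
  inS m' q' y -> inS m q y.
Proof.
move=> i i' le xx' [km' Qq' qy'].
have [[-> ->] //|[lt ne]] := nest i i' le xx'.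
by have [km Qq qx] := i; split=> //; have := tri q' q y; lia.
Qed.

Let inS_h m q x : k <= m -> Q m q -> d p x + a <= R m -> inS m q (h m q x).
Proof.
move=> km Qq px; split=> //; rewrite (liso_dist (sites_chart st Qq)) //.
by have := Rt m; lia.
Qed.

Let inS_p m q x : k <= m -> Q m q -> d p x + a <= R m -> inS m p x.
Proof. by move=> km Qq px; split=> //; have [] := sites_root st Qq. Qed.

Let key_region m q x y : k <= m -> Q m q -> d p x + a <= R m ->
  d (h m q x) y <= G -> stage y <= stage (h m q x) ->
  exists2 z, d p z + a <= R m & h m q z = y.
Proof.
move=> km Qq px xy le.
have iq := inS_h km Qq px; have sm := stage_le iq; have mN := inS_N iq.
have [|[u iu]] := stageP (h m q x); first lia.
have [|[u' iu']] := stageP y; first lia.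
have iuy := inS_trans iu iu' le xy iu'.
have [_ _ iqy] := inS_trans iq iu sm ltac:(by rewrite dxx) iuy.
have L := sites_chart st Qq; have [_ _ su] := L.
have [|z pz zy] := su y; first by have := Rt m; lia.
by exists z => //; rewrite -(liso_dist L pz) zy.
Qed.

Let inS_fwd m q x j u : k <= m -> Q m q -> d p x + a <= R m -> j < m -> inS j u x ->
  inS j (h m q u) (h m q x) /\ d p u + R j + S j <= R m.
Proof.
move=> km Qq px jm iu; have ip := inS_p km Qq px.
have [[? _]|[_ le]] := nest ip iu (ltnW jm) ltac:(by rewrite dxx); first lia.
have [kj Qu ux] := iu; split=> //; split=> //.
  by apply/(sites_coh st jm Qq le).
have [_ dE _] := sites_chart st Qq; rewrite dE //; have := Rt m; lia.
Qed.

Let inS_bwd m q x j u' : k <= m -> Q m q -> d p x + a <= R m -> j < m ->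
  inS j u' (h m q x) -> exists u, inS j u x.
Proof.
move=> km Qq px jm iu; have iq := inS_h km Qq px.
have [[? _]|[_ le]] := nest iq iu (ltnW jm) ltac:(by rewrite dxx); first lia.
have L := sites_chart st Qq; have [_ dE su] := L.
have [|u pu uu'] := su u'; first by have := Rt m; lia.
have pu' : d p u = d q u' by rewrite -uu' (liso_dist L).
have [kj Qu ux] := iu; exists u; split=> //.
  by apply/(sites_coh st jm Qq); rewrite ?pu' ?uu'.
by rewrite -(dE u x) ?uu' //; have := Rt m; lia.
Qed.

Let stage_inv m q x : k <= m -> Q m q -> d p x + a <= R m ->
  stage (h m q x) = stage x.
Proof.
move=> km Qq px; have sm := stage_le (inS_h km Qq px).
have sm' := stage_le (inS_p km Qq px); have mN := inS_N (inS_p km Qq px).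
have A : stage x < m -> stage (h m q x) <= stage x.
  move=> lt; have [|[u iu]] := stageP x; first lia.
  by have [/stage_le] := inS_fwd km Qq px lt iu.
have B : stage (h m q x) < m -> stage x <= stage (h m q x).
  move=> lt; have [|[u iu]] := stageP (h m q x); first lia.
  by have [u' /stage_le] := inS_bwd km Qq px lt iu.
lia.
Qed.

Let rep x z := (stage x = N.+1 /\ z = x) \/
  exists q, [/\ inS (stage x) q x, d p z + a <= R (stage x) & h (stage x) q z = x].

Let rep_ex x : exists z, rep x z.
Proof.
have [?|[q iq]] := stageP x; first by exists x; left.
have [_ Qq qx] := iq; have L := sites_chart st Qq; have [_ dE su] := L.
have [|z pz zx] := su x; first by have := Rt (stage x); lia.
by exists z; right; exists q; split=> //; rewrite -(liso_dist L pz) zx.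
Qed.

Let rep_uniq x z z' : rep x z -> rep x z' -> z = z'.
Proof.
move=> [[sN ->]|[q [iq pz zx]]] [[sN' ->]|[q' [iq' pz' zx']]] //.
- by have := inS_N iq'; lia.
- by have := inS_N iq; lia.
have [[_ ?]|[]] := nest iq iq' (leqnn _) ltac:(by rewrite dxx); last lia.
subst q'; have [_ Qq _] := iq.
by apply: (liso_inj con (sites_chart st Qq)); rewrite ?zx ?zx' //; have := Rt (stage x); lia.
Qed.

Let rep_inv m q x z : k <= m -> Q m q -> d p x + a <= R m -> rep x z ->
  rep (h m q x) z.
Proof.
move=> km Qq px; have ip := inS_p km Qq px; have sm := stage_le ip.
have mN := inS_N ip.
move=> [[sN _]|[u [iu pz zx]]]; first lia.
right; rewrite stage_inv //; have [lt|ge] := ltnP (stage x) m.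
  have [iu' le] := inS_fwd km Qq px lt iu; exists (h m q u); split=> //.
  have [_ Qu _] := iu.
  by rewrite (sites_comp st lt Qq le Qu) ?zx //; lia.
have sE : stage x = m by lia.
rewrite sE in iu pz zx *.
have [[_ ?]|[]] := nest iu ip (leqnn _) ltac:(by rewrite dxx); last lia.
subst u; have [_ Qp _] := ip.
have zx' : z = x by rewrite -zx (sites_id st Qp) //; have := Rt m; lia.
by rewrite zx'; exists q; split=> //; apply: inS_h.
Qed.

(** The keys, made of the stage and of a code of the representative, are the order
along which all choices are made.  The code 0 is kept for p, so that p comes first. *)
Lemma key_exists : exists ks kc : X -> nat,
  [/\ forall m q x, k <= m -> Q m q -> d p x + a <= R m ->
        ks (h m q x) = ks x /\ kc (h m q x) = kc x,
      forall m q x y, k <= m -> Q m q -> d p x + a <= R m ->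
        d (h m q x) y <= G -> ks y <= ks (h m q x) ->
        exists2 z, d p z + a <= R m & h m q z = y,
      forall x y, ks x = ks y -> kc x = kc y -> d x y <= G -> x = y
    & forall y, ks p <= ks y /\ kc p = 0].
Proof.
have [rp rpP] := choice rep_ex.
pose code z := if z == p then 0 else (choice.pickle z).+1.
have code_inj z z' : code z = code z' -> z = z'.
  rewrite /code; case: eqP => [->|_]; case: eqP => [-> //|_] //.
  by move=> [] /(pcan_inj choice.pickleK).
exists stage, (fun x => code (rp x)); split.
- move=> m q x km Qq px; split; first exact: stage_inv.
  congr code; apply: rep_uniq (rpP _) _; exact: rep_inv.
- exact: key_region.
- move=> x y sE /code_inj rE xy; have := rpP x; have := rpP y; rewrite -rE /rep -sE.
  move=> [[sN yE]|[q [iq pz zx]]] [[sN' xE]|[q' [iq' pz' zx']]].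
  + by rewrite -xE.
  + by have := inS_N iq'; lia.
  + by have := inS_N iq; lia.
  have [[_ qE]|[]] := nest iq iq' (leqnn _) ltac:(by rewrite dC); last lia.
  by rewrite -zx' -qE.
move=> y; have pS m q : inS m q y -> inS m p p.
  by move=> [km Qq qy]; have [_ Qp] := sites_root st Qq; split=> //; rewrite dxx; lia.
split.
  have [->|[q /pS/stage_le//]] := stageP y.
  by apply: least_min; left.
suff -> : rp p = p by rewrite /code eqxx.
have [[_ ->] //|[q [iq pz zp]]] := rpP p.
have ip : inS (stage p) p p.
  have [km Qq qp] := iq; have [_ Qp] := sites_root st Qq.
  by split=> //; rewrite dxx; lia.
have [[_ qE]|[]] := nest iq ip (leqnn _) ltac:(by rewrite dxx); last lia.
have [_ Qp _] := ip; rewrite qE (sites_id st Qp) // in zp.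
by have := Rt (stage p); lia.
Qed.

(** The chart of the smallest site is composed with the charts of larger sites: this
yields compatible charts for the sites of the next lower level. *)
Lemma stage_charts : exists (ks : X -> nat) (rp : X -> X) (ch : X -> X -> X),
  [/\ forall x, (ks x = N.+1 /\ rp x = x) /\ ch x = id \/
        exists q, [/\ k <= ks x, Q (ks x) q, d p (rp x) + a <= R (ks x),
          h (ks x) q (rp x) = x & ch x = h (ks x) q],
      forall m q x, k <= m -> Q m q -> d p x + a <= R m ->
        [/\ ks x <= m, rp (h m q x) = rp x & forall w, d p w <= R (ks x) ->
        ch (h m q x) w = h m q (ch x w)]
    & rp p = p /\ forall w, d p w <= t (ks p) -> ch p w = w].
Proof.
have [rp rpP] := choice rep_ex.
have /choice[qs qsP] : forall x, exists q, stage x = N.+1 \/ inS (stage x) q x.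
  by move=> x; have [?|[q iq]] := stageP x; [exists p; left|exists q; right].
exists stage, rp, (fun x => if stage x == N.+1 then id else h (stage x) (qs x)); split.
- move=> x; have [[sN ->]|[q [iq pz zx]]] := rpP x; first by left; rewrite sN eqxx.
  right; have sxN := inS_N iq; exists (qs x); have [sN|iq'] := qsP x; first lia.
  have [[_ qE]|[]] := nest iq iq' (leqnn _) ltac:(by rewrite dxx); last lia.
  have [kx Qq _] := iq; rewrite -qE; split=> //; first by case: eqP => //; lia.
- move=> m q x km Qq px; have sm := stage_le (inS_p km Qq px).
  have mN := inS_N (inS_p km Qq px).
  have rE : rp (h m q x) = rp x.
    by apply: rep_uniq (rpP _) _; apply: rep_inv.
  split=> // w pw; have sE := stage_inv km Qq px; rewrite sE.
  case: eqP => [|_]; first lia.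
  have [sN|iu] := qsP x; first lia.
  have [sN|iu'] := qsP (h m q x); first lia.
  have [lt|ge] := ltnP (stage x) m.
    have [iu2 le] := inS_fwd km Qq px lt iu.
    have := nest iu' iu2; rewrite sE => /(_ (leqnn _) ltac:(by rewrite dxx)).
    move=> [[_ ->]|[]]; last lia.
    by have [_ Qu _] := iu; rewrite (sites_comp st lt Qq le Qu).
  have E : stage x = m by lia.
  have := nest iu' (inS_h km Qq px); rewrite sE E => /(_ (leqnn _) ltac:(by rewrite dxx)).
  move=> [[_ ->]|[]]; last lia.
  have := nest iu (inS_p km Qq px); rewrite E => /(_ (leqnn _) ltac:(by rewrite dxx)).
  move=> [[_ ->]|[]]; last lia.
  have [_ Qp _] := inS_p km Qq px.
  by rewrite (sites_id st Qp) //; have := Rt m; rewrite E in pw; lia.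
have [[sN rpE]|[q [iq pz zx]]] := rpP p; first by rewrite sN eqxx.
have sxN := inS_N iq; have [kx Qq qp] := iq; have [_ Qp] := sites_root st Qq.
have ip : inS (stage p) p p by split=> //; rewrite dxx; lia.
have [sN|iq'] := qsP p; first lia.
have [[_ qE]|[]] := nest iq ip (leqnn _) ltac:(by rewrite dxx); last lia.
have [[_ qE']|[]] := nest iq' ip (leqnn _) ltac:(by rewrite dxx); last lia.
rewrite qE (sites_id st Qp) // in zx; last by have := Rt (stage p); lia.
split=> // w pw; case: eqP => [|_]; first lia.
by rewrite qE' (sites_id st Qp).
Qed.
End Key.

(** Each vertex takes the least label allowed at it that is not in conflict with the
labels taken at smaller keys.  A chart maps the competitors of smaller key of x onto
those of its image, so that the labels are invariant by induction on the key. *)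
Lemma greedy k a G (allowed : X -> nat -> Prop) (bad : X -> nat -> X -> nat -> Prop) :
  (forall m, k <= m -> m <= N -> G <= S m) ->
  (forall x n y m, bad x n y m -> bad y m x n) ->
  (forall x n y m, bad x n y m -> x <> y /\ d x y <= G) ->
  (forall x (g : X -> nat), exists n, allowed x n /\ forall y, ~ bad x n y (g y)) ->
  (forall m q x n, k <= m -> Q m q -> d p x + a <= R m ->
     (allowed x n <-> allowed (h m q x) n)) ->
  (forall m q x y n n', k <= m -> Q m q -> d p x + a <= R m -> d p y + a <= R m ->
     (bad x n y n' <-> bad (h m q x) n (h m q y) n')) ->
  exists F : X -> nat,
    [/\ forall x, allowed x (F x),
        forall x y, ~ bad x (F x) y (F y),
        invd k a F,
        forall x n, n < F x -> allowed x n -> exists y, bad x n y (F y)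
      & allowed p 0 -> F p = 0].
Proof.
move=> GS bsym bG ex ainv binv.
have [ks [kc [K1 K2 K3 K4]]] := key_exists a GS.
pose ear y x := ks y < ks x \/ (ks y = ks x /\ kc y < kc x).
have wf : well_founded ear.
  move=> x; move: {2}(ks x) (erefl (ks x)) => n; elim/ltn_ind: n x => n IHn x.
  move: {2}(kc x) (erefl (kc x)) => c; elim/ltn_ind: c x => c IHc x cx nx.
  constructor=> y [lt|[eq lt]]; first by apply: (IHn (ks y)); rewrite -?nx.
  by apply: (IHc (kc y)); rewrite -?cx ?eq.
pose step x (rec : forall y, ear y x -> nat) :=
  least (fun n => allowed x n /\ forall y yx, ~ bad x n y (rec y yx)).
pose F := Fix wf (fun _ => nat) step.
pose good x n := allowed x n /\ forall y, ear y x -> ~ bad x n y (F y).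
have FE x : F x = least (good x).
  rewrite /F Fix_eq; first exact: eq_least.
  by move=> z f g fg; apply: eq_least => n; split=> -[al nb]; split=> // y yz; 
    [rewrite -fg|rewrite fg].
have Fgood x : good x (F x).
  by rewrite FE; apply: leastP; have [n [al nb]] := ex x F; exists n; split.
have tot x y : x <> y -> d x y <= G -> ear x y \/ ear y x.
  move=> xy dxy; have [lt|gt|eq] := ltngtP (ks x) (ks y); [by left; left|by right; left|].
  have [lt|gt|eq'] := ltngtP (kc x) (kc y); [by left; right|by right; right|].
  by case: xy; apply: K3.
exists F; split.
- by move=> x; have [] := Fgood x.
- move=> x y b; have [xy dxy] := bG _ _ _ _ b.
  have [xy'|yx] := tot _ _ xy dxy; last by have [_ /(_ _ yx)] := Fgood x.
  by have [_ /(_ _ xy')] := Fgood y; apply; apply: bsym.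
- move=> m q x; elim/(well_founded_ind wf): x m q => x IH m q km Qq px.
  rewrite !FE; apply: eq_least => n.
  have earE z : d p z + a <= R m -> (ear (h m q z) (h m q x) <-> ear z x).
    move=> pz; rewrite /ear.
    by have [-> ->] := K1 m q z km Qq pz; have [-> ->] := K1 m q x km Qq px.
  split=> -[al nb]; (split; first by have := ainv m q x n km Qq px; tauto) => y yx b.
    have [_ xy] := bG _ _ _ _ b.
    have Qp := (sites_root st Qq).2.
    have hid z : d p z + a <= R m -> h m p z = z.
      by move=> pz; rewrite (sites_id st Qp) //; have := Rt m; lia.
    have le : ks y <= ks x by case: yx; lia.
    have [||z pz zy] := K2 m p x y km Qp px; rewrite ?hid //.
    rewrite hid // in zy; subst z.
    apply: (nb (h m q y)); first by apply/earE.
    by rewrite (IH y yx m q) //; apply: (binv m q x y n (F y) km Qq px pz).1.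
  have [_ xy] := bG _ _ _ _ b.
  have le : ks y <= ks (h m q x) by case: yx; lia.
  have [z pz zy] := K2 m q x y km Qq px xy le; subst y.
  have zx : ear z x by apply/earE.
  by apply: (nb z) => //; apply: (binv m q x z n (F z) km Qq px pz).2; rewrite -(IH z zx m q).
- move=> x n lt al; apply: contrapT => nb.
  have : good x n by split=> // y _ b; apply: nb; exists y.
  by move=> /least_min; rewrite -FE; lia.
- move=> al; apply/eqP; rewrite -leqn0 FE; apply: least_min; split=> // y.
  by have [] := K4 y; rewrite /ear; lia.
Qed.
End Sites.

Section Nets.
Variables (X : countType) (e : rel X) (Delta : nat).
Hypothesis hG : infinite_simple_graph e Delta.
Let sym : symmetric e. Proof. by case: hG. Qed.
Let con : connected_graph e. Proof. by case: hG. Qed.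
Let deg : degree_of_graph e Delta. Proof. by case: hG. Qed.
Local Notation d := (gdist e).
Local Notation tri := (gdist_tri con).
Local Notation dC := (gdistC sym con).
Local Notation dxx := (gdistxx e).
Local Notation ball := (ball e).
Let inB x r y : (y \in ball x r) = (d x y <= r) := in_ball con deg x r y.

Variables (N : nat) (R S t : nat -> nat) (p : X).
Variables (Q : nat -> X -> Prop) (h : nat -> X -> X -> X).
Hypothesis st : sites e N R S t p Q h.
Hypothesis Rt : forall m, R m <= t m.
Local Notation invd := (invd e R p Q h).

Lemma chart_dist m q x y : Q m q -> d p x <= R m -> d p y <= R m ->
  d (h m q x) (h m q y) = d x y.
Proof.
by move=> Qq px py; have [_ dE _] := sites_chart st Qq; rewrite dE //; have := Rt m; lia.
Qed.

(** First-fit coloring; the vertices of color 0 then form a maximal separated set. *)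
Lemma first_fit k a r (A : X -> Prop) : (forall m, k <= m -> m <= N -> r <= S m) ->
  invd k a A -> exists F : X -> nat,
    [/\ forall x y, A x -> A y -> F x = F y -> d x y <= r -> x = y,
        invd k a F,
        forall x n, n < F x -> exists y, [/\ A x, A y, d x y <= r & F y = n]
      & F p = 0].
Proof.
move=> rS Ai; pose bad x (n : nat) y m := [/\ A x, A y, x <> y, d x y <= r & n = m].
have [|||||F [_ F1 F2 F3 F4]] := @greedy _ e sym con N R S t p Q h st Rt k a r
    (fun _ _ => True) bad rS.
- by move=> x n y m [Ax Ay xy dxy nm]; split=> //; [exact: nesym|rewrite dC].
- by move=> x n y m [].
- move=> x g; exists (\max_(y <- ball x r) g y).+1; split=> // y [_ _ _ xy].
  have yB : y \in ball x r by rewrite inB.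
  have : g y <= \max_(y <- ball x r) g y by apply: leq_bigmax_seq.
  by move=> le nE; rewrite -nE ltnn in le.
- by [].
- move=> m q x y n n' km Qq px py; rewrite /bad !(Ai m q) // chart_dist //; try lia.
  split=> -[Ax Ay xy dxy nm]; split=> // xy'; apply: xy; last by rewrite xy'.
  have := chart_dist Qq (x := x) (y := y) ltac:(lia) ltac:(lia).
  by rewrite xy' dxx => /esym; apply: (gdist0 con).
exists F; split=> //; last exact: F4.
- by move=> x y Ax Ay Fxy dxy; apply: contrapT => xy; apply: (F1 x y); split.
- move=> x n nF; have [//|y [Ax Ay xy dxy nE]] := F3 x n nF.
  by exists y; split.
Qed.

Lemma maximal_separated k a r (A : X -> Prop) : (forall m, k <= m -> m <= N -> r <= S m) ->
  invd k a A -> exists I : X -> Prop,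
    [/\ forall x, I x -> A x, forall x y, I x -> I y -> d x y <= r -> x = y,
        forall x, A x -> exists2 y, I y & d x y <= r, invd k a I & A p -> I p].
Proof.
move=> rS Ai; have [F [F1 F2 F3 F4]] := first_fit rS Ai.
exists (fun x => A x /\ F x = 0); split=> [x []|x y [Ax Fx] [Ay Fy]|x Ax|m q x km Qq px|Ap] //.
- by apply: F1 => //; rewrite Fx.
- have [Fx|Fx] := posnP (F x); first by exists x; rewrite ?dxx.
  by have [y [_ Ay xy Fy]] := F3 x 0 Fx; exists y.
- by rewrite (Ai m q) // (F2 m q).
Qed.

(** Names which are unambiguous in every ball of radius r / 2, and invariant: they
allow invariant choices inside such a ball. *)
Lemma local_naming k a r : (forall m, k <= m -> m <= N -> r <= S m) ->
  exists col : X -> nat, invd k a col /\ forall x y, col x = col y -> d x y <= r -> x = y.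
Proof.
move=> rS; have [//|F [F1 F2 _ _]] := @first_fit k a r (fun _ => True) rS.
by exists F; split=> // x y; apply: F1.
Qed.

Lemma card_ball_liso r x y f u a : liso e r x y f -> d x u + a <= r ->
  #|` ball (f u) a| = #|` ball u a|.
Proof.
move=> L le; have L' := liso_restr con L le; apply/eqP; rewrite eqn_leq.
apply/andP; split.
  apply: (card_inj (R := fun v w => d u w <= a /\ f w = v)) => [v|v v' w _ _ [_ <-] [_ <-]] //.
  rewrite inB; have [_ _ su] := L' => /su[w uw fw]; exists w => //.
  by rewrite inB.
apply: (card_inj (R := fun v w => d u v <= a /\ f v = w)) => [v|v v' w _ _ [uv fv] [uv' fv']].
  rewrite inB => uv; exists (f v) => //; rewrite inB.
  by rewrite (liso_dist L').
by apply: (liso_inj con L') => //; rewrite fv.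
Qed.

(** * Nets of fat and thin roots *)

(** [Mf] and [Mt] are the fat and the thin roots.  [net_tfat] says more than [net_ft]: it
excludes all fat elements of B. *)
Record net k a (B : X -> Prop) s sig K1 rho1 W (Mf Mt : X -> Prop) : Prop := Net {
  net_f : forall c, Mf c -> B c /\ W <= #|` ball c rho1|;
  net_t : forall c, Mt c -> B c /\ #|` ball c rho1| < W;
  net_sep : forall c c', Mf c \/ Mt c -> Mf c' \/ Mt c' -> d c c' <= sig -> c = c';
  net_near : forall x, (exists2 c, Mf c & d x c <= K1 + s) \/
                       (exists2 c, Mt c & d x c <= s + sig);
  net_ft : forall c c', Mt c -> Mf c' -> K1 < d c c';
  net_tfat : forall c b, Mt c -> B b -> W <= #|` ball b rho1| -> K1 < d c b + sig;
  net_invf : invd k a Mf;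
  net_invt : invd k (a + K1) Mt
}.

(** A maximal separated set of fat points, completed by a maximal separated set of the
points of B that are at distance more than K1 from it.  The latter are thin, since a fat
point is within sig of a fat root. *)
Lemma net_exists k a (B : X -> Prop) s sig K1 rho1 W :
  (forall m, k <= m -> m <= N -> sig <= S m) ->
  (forall m, k <= m -> m <= N -> R m + rho1 <= t m) ->
  sig <= K1 -> invd k a B -> (forall x, exists2 b, B b & d x b <= s) ->
  exists Mf Mt, net k a B s sig K1 rho1 W Mf Mt.
Proof.
move=> sS Rt1 sK Bi Bd.
pose A x := B x /\ W <= #|` ball x rho1|.
have Ai : invd k a A.
  move=> m q x km Qq px; rewrite /A (Bi m q) //.
  have [mN _] := sites_root st Qq.
  by rewrite (card_ball_liso (sites_chart st Qq)) //; have := Rt1 m km mN; lia.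
have [Mf [f1 f2 f3 f4 _]] := maximal_separated sS Ai.
pose T b := B b /\ forall c, Mf c -> K1 < d b c.
have Ti : invd k (a + K1) T.
  move=> m q x km Qq px; have [mN _] := sites_root st Qq.
  rewrite /T (Bi m q) //; last lia.
  apply/propext; split=> -[Bx far]; split=> // c Mc; rewrite ltnNge; apply/negP => le.
    have pc : d p c + a <= R m by have := tri x p c; lia.
    have := far (h m q c); rewrite chart_dist //; try lia.
    by rewrite (f4 m q) // => /(_ Mc); lia.
  have L := sites_chart st Qq; have [_ dE su] := L.
  have qx : d q (h m q x) = d p x by rewrite (liso_dist L) //; have := Rt m; lia.
  have [|c' pc cE] := su c; first by have := tri (h m q x) q c; have := Rt m; lia.
  have pc' : d p c' + a <= R m.
    rewrite -(liso_dist L pc) cE; have := tri (h m q x) q c; lia.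
  rewrite -cE (f4 m q) // in Mc; have := far _ Mc.
  by rewrite -cE chart_dist // in le; lia.
have [Mt [t1 t2 t3 t4 _]] := maximal_separated sS Ti.
have ft c c' : Mt c -> Mf c' -> K1 < d c c' by move=> /t1[_ far] /far.
exists Mf, Mt; split=> //.
- move=> c Mc; have [Bc far] := t1 _ Mc; split=> //; rewrite ltnNge; apply/negP => fat.
  by have [c' Mc' cc'] := f3 c (conj Bc fat); have := far _ Mc'; lia.
- move=> c c' [Mc|Mc] [Mc'|Mc'] le; [exact: f2| | |exact: t2].
    by have := ft _ _ Mc' Mc; rewrite dC; lia.
  by have := ft _ _ Mc Mc'; lia.
- move=> x; have [b Bb xb] := Bd x.
  have [[c Mc bc]|h0] := pselect (exists2 c, Mf c & d b c <= K1).
    by left; exists c => //; have := tri b x c; lia.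
  right; have [|c Mc bc] := t3 b; last by exists c => //; have := tri b x c; lia.
  by split=> // c Mc; rewrite ltnNge; apply/negP => le; apply: h0; exists c.
- move=> c b Mc Bb fat; have [c' Mc' bc'] := f3 b (conj Bb fat).
  by have := ft _ _ Mc Mc'; have := tri b c c'; lia.
Qed.
End Nets.

(** * Levels of the construction *)

(** The numbers attached to one level.  The codes are written within distance [rho] of
the roots, [L] is the radius on which the coloring around a root has to be known, and
[sig] separates the roots.  Thin roots compete up to distance [G0] and fat roots up to
[G1].  Every vertex is within [Kmax] of a root, [K1] is the distance kept between thin and
fat roots, and [K0] is the rank of thin roots at level 0.  To conclude that an
isomorphism fixes x, the fat roots within [D2] of x and the thin roots within [D3] have
to be fixed.  By the last two conditions, w carriers give more codes than three times the
number of competitors, if w has the size that the ball of a root guarantees;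
the factor 3 counts the symbols of the competitor. *)
Record consts (Delta s l lam eps rho W L sig D3 G0 K0 K1 Kmax D2 G1 : nat) : Prop :=
Consts {
  c_L : L = rho + lam + l;
  c_sig : sig = 2 * L + 20;
  c_D3 : D3 = 3 * (2 * L + s + sig);
  c_G0 : G0 = eps + 2 * D3;
  c_K0 : K0 = G0 + sig + s;
  c_K1 : K1 = K0 + 2 * L;
  c_Km : Kmax = K1 + s + sig;
  c_D2 : D2 = 3 * Kmax;
  c_G1 : G1 = eps + 2 * D2;
  c_t2 : 4 * s + 10 <= rho;
  c_lam : 10 <= lam;
  c_step : G0 <= 30 * (rho - s - s);
  c_thin : forall w, rho - s < (w + Delta.+1 ^ (4 * s + 10)) * Delta.+1 ^ s ->
             3 * W ^ 30 < 2 ^ w;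
  c_fat : forall w, W <= (w + Delta.+1 ^ (4 * s + 10)) * Delta.+1 ^ s ->
             3 * Delta.+1 ^ G1 < 2 ^ w
}.

Section Levels.
Variables (X : countType) (e : rel X).
Local Notation d := (gdist e).
Variables (R : nat -> nat) (p : X).
Variables (Q : nat -> X -> Prop) (h : nat -> X -> X -> X) (Fr : nat -> nat).
Local Notation invd := (invd e R p Q h).

Definition supp (B : X -> Prop) (T : X -> option bool) := forall x, T x <> None -> B x.

(** A coloring [Phi T] for every assignment T of symbols to the carriers B of the next
level: [None] is blank, [Some false] is a bit, and [Some true] marks a root.  Isomorphisms
of radius [lam] between colorings with possibly different symbols preserve the symbols
and move no point by less than [eps], unless they fix it.  By [lv_froz], the sites of
level at most k are already copies of the ball around p, whatever the symbols are. *)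
Record level (C : Type) k a s l lam eps (B : X -> Prop)
    (Phi : (X -> option bool) -> X -> C) : Prop := Level {
  lv_dens : forall x, exists2 b, B b & d x b <= s;
  lv_loc : forall T T' x, (forall u, d x u <= l -> T u = T' u) -> Phi T x = Phi T' x;
  lv_rec : forall T T' x y f, supp B T -> supp B T' ->
    ciso e lam x y f (Phi T) (Phi T') -> T x = T' y;
  lv_dist : forall T T' x y f, supp B T -> supp B T' ->
    ciso e lam x y f (Phi T) (Phi T') -> d x y < eps -> x = y;
  lv_invB : invd k.+1 a B;
  lv_inv : forall m q x T T', k < m -> Q m q -> d p x + a <= R m ->
    (forall u, d x u <= l -> T' (h m q u) = T u) -> Phi T' (h m q x) = Phi T x;
  lv_froz : forall m q x T, m <= k -> Q m q -> supp B T -> d p x <= Fr m ->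
    Phi T (h m q x) = Phi T x
}.

(** Near the roots, the marks of the roots themselves have to stay readable. *)
Definition adm (B M : X -> Prop) (P : X -> bool) :=
  forall x, P x -> B x /\ forall c, M c -> 8 < d c x.

(** The situation of level k once its roots are known but not their codes: [Psi P] is
the coloring with roots [Mf] and [Mt] and with bits P.  Codes can be written because
an isomorphism preserves roots and bits, because it leaves every bit around a root
in place if it fixes this root, and because it fixes every point around which it
fixes the roots. *)
Record prelevel (C : Type) k a l lam rho D2 D3 D4 (B Mf Mt : X -> Prop)
    (Psi : (X -> bool) -> X -> C) : Prop := Prelevel {
  pl_rec : forall P P' x y f, adm B (fun c => Mf c \/ Mt c) P ->
    adm B (fun c => Mf c \/ Mt c) P' ->
    ciso e lam x y f (Psi P) (Psi P') ->
    ((Mf x \/ Mt x) <-> (Mf y \/ Mt y)) /\ P x = P' y;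
  pl_rig : forall P P' c f, Mf c \/ Mt c -> adm B (fun c => Mf c \/ Mt c) P ->
    adm B (fun c => Mf c \/ Mt c) P' ->
    ciso e (rho + lam) c c f (Psi P) (Psi P') -> forall u, d c u <= rho -> P u = P' u;
  pl_fin : forall P P' x y f, adm B (fun c => Mf c \/ Mt c) P ->
    adm B (fun c => Mf c \/ Mt c) P' ->
    ciso e D4 x y f (Psi P) (Psi P') ->
    (forall c, Mf c -> d x c <= D2 -> f c = c) ->
    (forall c, Mt c -> d x c <= D3 -> f c = c) -> f x = x;
  pl_loc : forall P P' x, (forall u, d x u <= l -> P u = P' u) -> Psi P x = Psi P' x;
  pl_inv : forall m q x P P', k <= m -> Q m q -> d p x + a <= R m ->
    (forall u, d x u <= l -> P' (h m q u) = P u) -> Psi P' (h m q x) = Psi P x;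
  pl_froz : forall m q x P, m < k -> Q m q -> adm B (fun c => Mf c \/ Mt c) P ->
    d p x <= Fr m -> Psi P (h m q x) = Psi P x
}.
End Levels.

Section Code.
Variables (X : countType) (e : rel X) (Delta : nat).
Hypothesis hG : infinite_simple_graph e Delta.
Let sym : symmetric e. Proof. by case: hG. Qed.
Let con : connected_graph e. Proof. by case: hG. Qed.
Let inf : infinite_set [set: X]. Proof. by case: hG. Qed.
Let deg : degree_of_graph e Delta. Proof. by case: hG. Qed.
Local Notation d := (gdist e).
Local Notation tri := (gdist_tri con).
Local Notation dC := (gdistC sym con).
Local Notation dxx := (gdistxx e).
Local Notation ball := (ball e).
Local Notation V := Delta.+1.
Let inB x r y : (y \in ball x r) = (d x y <= r) := in_ball con deg x r y.

Variables (N : nat) (R S t : nat -> nat) (p : X).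
Variables (Q : nat -> X -> Prop) (h : nat -> X -> X -> X) (Fr : nat -> nat).
Hypothesis st : sites e N R S t p Q h.
Hypothesis Rt : forall m, R m <= t m.
Local Notation invd := (invd e R p Q h).

Variables (C : Type) (k a0 a1 s l lam eps rho W L sig D3 G0 K0 K1 Kmax D2 G1 : nat).
Hypothesis hc : consts Delta s l lam eps rho W L sig D3 G0 K0 K1 Kmax D2 G1.
Let cL := c_L hc.
Let csig := c_sig hc.
Let cD3 := c_D3 hc.
Let cG0 := c_G0 hc.
Let cK0 := c_K0 hc.
Let cK1 := c_K1 hc.
Let cKm := c_Km hc.
Let cD2 := c_D2 hc.
Let cG1 := c_G1 hc.
Let ct2 := c_t2 hc.
Let cstep := c_step hc.
Let clam := c_lam hc.
Local Notation t1 := (2 * s + 9).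
Local Notation t2 := (4 * s + 10).
Local Notation D4 := (D2 + Kmax + L + 20).

Variables (B Mf Mt : X -> Prop) (Psi : (X -> bool) -> X -> C).
Hypothesis Bd : forall x, exists2 b, B b & d x b <= s.
Hypothesis Bi : invd k a0 B.
Hypothesis hM : net e R p Q h k a0 B s sig K1 (rho - s) W Mf Mt.
Hypothesis hP : prelevel e R p Q h Fr k a1 l lam rho D2 D3 D4 B Mf Mt Psi.
Hypothesis a01 : a0 + K1 <= a1.
Hypothesis GS : forall m, k <= m -> m <= N -> G1 <= S m.
Local Notation M c := (Mf c \/ Mt c).
Local Notation adm := (adm e B (fun c => M c)).

Let GS' x : x <= G1 -> forall m, k <= m -> m <= N -> x <= S m.
Proof. by move=> xG m km mN; apply: leq_trans xG (GS km mN). Qed.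

Let invM : invd k a1 (fun c => M c).
Proof.
move=> m q x km Qq px; rewrite (net_invf hM km Qq) ?(net_invt hM km Qq) //; lia.
Qed.

Let invB1 : invd k a1 B.
Proof. by apply: invd_le Bi _ _; rewrite ?leqnn //; lia. Qed.

Let sepM c c' : M c -> M c' -> d c c' <= sig -> c = c'.
Proof. exact: (net_sep hM). Qed.

(** ** Codes *)

Let col_ex : exists col : X -> nat, invd k a1 col /\
  forall x y, col x = col y -> d x y <= 2 * rho -> x = y.
Proof. apply: (local_naming hG st Rt); apply: GS'; lia. Qed.

(** A code is a number that encodes a finite set of names of carriers; the names make
codes comparable with their copies in other sites. *)
Definition decode (n : nat) : pred nat :=
  if (choice.unpickle n : option (seq nat)) is Some u then fun i => i \in u else xpred0.

Lemma decodeP (u : seq nat) i : decode (choice.pickle u) i = (i \in u).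
Proof. by rewrite /decode choice.pickleK. Qed.

Section Pattern.
Variable col : X -> nat.
Hypothesis coli : invd k a1 col.
Hypothesis col_inj : forall x y, col x = col y -> d x y <= 2 * rho -> x = y.

(** The symbol v occupies two annuli next to the root c, each of which is filled with bits
or left empty, and the code n is written farther away. *)
Definition pattern c n (v : option bool) : X -> bool := fun b =>
  `[< B b /\ [\/ 8 < d c b <= t1 /\ v = Some false,
                 t1 < d c b <= t2 /\ v = Some true
               | t2 < d c b <= rho /\ decode n (col b)] >].

Lemma pattern_dist c n v b : pattern c n v b -> 8 < d c b <= rho.
Proof. by move=> /asboolP[_ []]; lia. Qed.

Lemma pattern_adm c n v : M c -> adm (pattern c n v).
Proof.
move=> Mc b Pb; have cb := pattern_dist Pb; have /asboolP[Bb _] := Pb.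
split=> // c' Mc'; have [le|gt] := leqP (d c c') sig.
  by rewrite -(sepM Mc Mc' le); lia.
by have := tri b c c'; rewrite (dC b c'); lia.
Qed.

Lemma pattern_inv m q c n v b : k <= m -> Q m q -> d p c + a1 + L <= R m -> d c b <= L ->
  pattern (h m q c) n v (h m q b) = pattern c n v b.
Proof.
move=> km Qq pc cb; have pb := tri c p b.
rewrite /pattern (chart_dist st Rt Qq); try lia.
by rewrite (invB1 km Qq) ?(coli km Qq) //; lia.
Qed.

Let chart_ciso m q c n v : k <= m -> Q m q -> d p c + a1 + L <= R m ->
  ciso e (rho + lam) c (h m q c) (h m q) (Psi (pattern c n v)) (Psi (pattern (h m q c) n v)).
Proof.
move=> km Qq pc; split.
  by apply: (chart_restr con st) => //; have := Rt m; lia.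
move=> u cu; apply: (pl_inv hP) => //; first by have := tri c p u; lia.
by move=> b ub; apply: pattern_inv => //; have := tri u c b; lia.
Qed.

(** Codes are not compared bit by bit, since an isomorphism does not preserve the names
of the carriers; what matters is whether the colored surroundings are isomorphic. *)
Definition confusable c n c' n' := exists v v' f,
  ciso e (rho + lam) c c' f (Psi (pattern c n v)) (Psi (pattern c' n' v')).

Definition conflict c c' :=
  c <> c' /\ ([/\ Mf c, Mf c' & d c c' <= G1] \/ [/\ Mt c, Mt c' & d c c' <= G0]).

Let bad c n c' n' := conflict c c' /\ confusable c n c' n'.

Let bad_sym c n c' n' : bad c n c' n' -> bad c' n' c n.
Proof.
move=> [[cc' co] [v [v' [f ff]]]]; split.
  split; first exact: nesym.
  by rewrite dC; case: co => -[? ? ?]; [left|right].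
by have [g [gg _ _]] := ciso_inv con ff; exists v', v, g.
Qed.

Let bad_inv m q c c' n n' : k <= m -> Q m q -> d p c + (a1 + L) <= R m ->
  d p c' + (a1 + L) <= R m -> (bad c n c' n' <-> bad (h m q c) n (h m q c') n').
Proof.
move=> km Qq pc pc'; rewrite !addnA in pc pc'.
have Mfi x : d p x + a1 + L <= R m -> Mf (h m q x) = Mf x.
  by move=> px; apply: (net_invf hM) => //; lia.
have Mti x : d p x + a1 + L <= R m -> Mt (h m q x) = Mt x.
  by move=> px; apply: (net_invt hM) => //; lia.
have dE : d (h m q c) (h m q c') = d c c' by apply: (chart_dist st Rt Qq); lia.
have inj : h m q c = h m q c' <-> c = c'.
  by split=> [E|-> //]; apply: (gdist0 con); rewrite -dE E dxx.
rewrite /bad /conflict !Mfi ?Mti // dE.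
have -> : (h m q c <> h m q c') = (c <> c') by apply/propext; tauto.
suff -> : confusable (h m q c) n (h m q c') n' = confusable c n c' n' by [].
apply/propext; split=> -[v [v' [f ff]]]; exists v, v'.
  have [g [gg _ _]] := ciso_inv con (chart_ciso n' v' km Qq pc').
  exists (g \o f \o h m q); apply: ciso_comp gg => //.
  by apply: ciso_comp ff => //; apply: chart_ciso.
have [g [gg _ _]] := ciso_inv con (chart_ciso n v km Qq pc).
exists (h m q \o f \o g); apply: ciso_comp (chart_ciso n' v' km Qq pc') => //.
exact: ciso_comp gg ff.
Qed.

Let carriers c := [fset b in ball c rho | `[< B b /\ t2 < d c b >]]%fset.

Let in_carriers c b : (b \in carriers c) = `[< B b /\ t2 < d c b <= rho >].
Proof.
rewrite /carriers !inE inB /=; apply/andP/asboolP => [[? /asboolP[? ?]]|[? ?]].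
  by split=> //; lia.
by split; [lia|apply/asboolP; split=> //; lia].
Qed.

(** The balls of radius s around the carriers of the code, or around the points near c,
cover the ball. *)
Let card_carriers c : #|` ball c (rho - s)| <= (#|` carriers c| + V ^ t2) * V ^ s.
Proof.
apply: (@leq_trans (size ((carriers c : seq X) ++ (ball c t2 : seq X)) * V ^ s)).
  apply: (card_cover (F := fun b => ball b s)) => [y|i _]; last exact: (card_ball_le con deg).
  rewrite inB => cy; have [b Bb yb] := Bd y.
  have cb := tri y c b; exists b; last by rewrite inB dC.
  rewrite mem_cat; apply/orP; have [le|gt] := leqP (d c b) t2.
    by right; rewrite inB.
  by left; rewrite in_carriers; apply/asboolP; split=> //; lia.
by rewrite size_cat leq_mul2r leq_add2l (card_ball_le con deg) orbT.
Qed.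

(** Near a thin root every ball of radius rho - 2s has at most W points, and a ball of
radius G0 is reached in 30 steps of this length. *)
Let thin_ball c : Mt c -> #|` ball c G0| <= W ^ 30.
Proof.
move=> Mc; set r := rho - s - s.
have thin y : d c y <= G0 -> #|` ball y r| <= W.
  move=> cy; have [b Bb yb] := Bd y.
  have cb : d c b <= G0 + s by have := tri y c b; lia.
  have : #|` ball b (rho - s)| < W.
    by rewrite ltnNge; apply/negP => /(net_tfat hM Mc Bb); lia.
  apply: leq_trans; apply: leqW; apply: fsubset_leq_card; apply/fsubsetP => z.
  by rewrite !inB => yz; have := tri y b z; rewrite (dC b y); lia.
have W0 : 0 < W by apply: leq_trans (thin c _); rewrite ?dxx // (leq_trans _ (card_ball_ge con deg inf c r)).
have ind i : #|` ball c (minn (i * r) G0)| <= W ^ i.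
  elim: i => [|i IH]; first by rewrite mul0n min0n (card_ball0 con deg).
  have le : minn (i.+1 * r) G0 <= minn (i * r) G0 + r by lia.
  apply: (@leq_trans #|` ball c (minn (i * r) G0 + r)|).
    by apply: fsubset_leq_card; apply/fsubsetP => z; rewrite !inB; lia.
  rewrite expnSr; apply: leq_trans (leq_mul IH (leqnn W)).
  by apply: (card_ball_cover con deg) => y cy; apply: thin; lia.
by have := ind 30; rewrite (minn_idPr _).
Qed.

(** If every set P of carriers were excluded by some competitor y with symbol v, one of
these pairs (v, y) would exclude two distinct sets.  The isomorphisms in question
compose to an isomorphism between the two colorings that fixes c, so the sets agree. *)
Let code_available c (g : X -> nat) : exists n, True /\ forall y, ~ bad c n y (g y).
Proof.
have [[Gc [NG cnt]]|noM] := pselect (exists Gc, (forall y n, bad c n y (g y) -> d c y <= Gc) /\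
    3 * #|` ball c Gc| < 2 ^ #|` carriers c|); last first.
  exists 0; split=> // y [co _]; apply: noM.
  case: co => cc' [[Mc Mc' _]|[Mc Mc' _]].
    exists G1; split.
      move=> z n [[_ [[_ _ //]|[Mc2 _ _]]] _].
      by have := net_ft hM Mc2 Mc; rewrite dxx.
    apply: leq_ltn_trans (c_fat hc _); last exact: leq_trans (net_f hM Mc).2 (card_carriers c).
    by rewrite leq_mul2l (card_ball_le con deg).
  exists G0; split.
    move=> z n [[_ [[Mc2 _ _]|[_ _ //]]] _].
    by have := net_ft hM Mc Mc2; rewrite dxx.
  apply: leq_ltn_trans (c_thin hc _); last exact: leq_trans (card_ball_ge con deg inf c _) (card_carriers c).
  by rewrite leq_mul2l thin_ball.
apply: contrapT => nex; move: cnt; apply/negP; rewrite -leqNgt -card_fpowerset.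
pose nm (P : {fset X}) := choice.pickle [seq col b | b <- P].
have all P : exists y, bad c (nm P) y (g y).
  by apply: contrapT => ny; apply: nex; exists (nm P); split=> // y b; apply: ny; exists y.
pose syms : {fset option bool} := [fset None; Some true; Some false]%fset.
apply: (@leq_trans #|` (syms `*` ball c Gc)%fset|); last first.
  have le1 : #|` syms| <= 3 by apply: leq_trans (leq_card_fsetU _ _).1 _; rewrite cardfs2 cardfs1.
  apply: (@leq_trans (size [seq (v, y) | v <- syms, y <- ball c Gc])).
    apply: uniq_leq_size => // -[v y]; rewrite in_fsetM => /andP[vs yB].
    by apply/allpairsP; exists (v, y).
  by rewrite size_allpairs leq_mul2r le1 orbT.
pose Rl (P : {fset X}) (vy : option bool * X) := conflict c vy.2 /\
  exists v f, ciso e (rho + lam) c vy.2 f (Psi (pattern c (nm P) v))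
     (Psi (pattern vy.2 (g vy.2) vy.1)).
apply: (card_inj (R := Rl)) => [P _|P P' [v' y]].
  have [y bP] := all P; have [co [v [v' [f ff]]]] := bP.
  exists (v', y); last by split=> //; exists v, f.
  rewrite in_fsetM /= inB (NG y (nm P)) // andbT.
  by case: v' {ff} => [[]|]; rewrite !inE.
rewrite !fpowersetE => Pc P'c [/= co [v [f ff]]] [_ [w [f' ff']]].
have Mc : M c by case: co => _ [[? _ _]|[? _ _]]; [left|right].
have [g' [gg' _ _]] := ciso_inv con ff'.
have same := pl_rig hP Mc (pattern_adm Mc) (pattern_adm Mc) (ciso_comp ff gg').
apply/fsetP => b; have [bc|bc] := boolP (b \in carriers c); last first.
  have nb P1 : (P1 `<=` carriers c)%fset -> b \notin P1.
    by move=> /fsubsetP sub; apply: contra bc; apply: sub.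
  by rewrite (negbTE (nb P Pc)) (negbTE (nb P' P'c)).
move: bc; rewrite in_carriers => /asboolP[Bb /andP[cb1 cb2]].
have memE P1 v1 : (P1 `<=` carriers c)%fset -> pattern c (nm P1) v1 b = (b \in P1).
  move=> /fsubsetP sub; apply/asboolP/idP => [[_ []]|bP]; try lia.
    rewrite decodeP => -[_ /mapP[b' b'P colE]].
    have := sub b' b'P; rewrite in_carriers => /asboolP[_ cb'].
    rewrite (col_inj colE) //; have := tri c b b'; rewrite (dC b c); lia.
  by split=> //; constructor 3; split; [lia|rewrite decodeP map_f].
by rewrite -(memE P v) // -(memE P' w) //; apply: same.
Qed.

(** ** Writing the codes and reading them *)

Lemma code_exists : exists code : X -> nat, invd k (a1 + L) code /\
  forall c c', conflict c c' -> ~ confusable c (code c) c' (code c').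
Proof.
have [|||||F [_ F1 F2 _ _]] := @greedy _ e sym con N R S t p Q h st Rt k (a1 + L) G1
    (fun _ _ => True) bad (GS' (leqnn _)).
- exact: bad_sym.
- move=> x n y m [[xy co] _]; split=> //.
  by case: co => -[_ _]; lia.
- exact: code_available.
- by [].
- by move=> m q x y n n' km Qq px py; apply: bad_inv.
by exists F; split=> // c c' co ba; apply: (F1 c c').
Qed.
End Pattern.

Section Encode.
Variable col : X -> nat.
Hypothesis coli : invd k a1 col.
Variable code : X -> nat.
Hypothesis codei : invd k (a1 + L) code.
Hypothesis code_ok : forall c c', conflict c c' -> ~ confusable col c (code c) c' (code c').

Let pat c v := pattern col c (code c) v.

Let pat_dist c v b : pat c v b -> 8 < d c b <= rho.
Proof. exact: pattern_dist. Qed.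

Definition encode (T : X -> option bool) : X -> bool :=
  fun b => `[< exists2 c, M c & pat c (T c) b >].

Let encodeE T c b : M c -> d c b <= L -> encode T b = pat c (T c) b.
Proof.
move=> Mc cb; apply/asboolP/idP => [[c' Mc' Pb]|Pb]; last by exists c.
rewrite (sepM Mc Mc') //; have := pat_dist Pb; have := tri b c c'.
by rewrite (dC b c'); lia.
Qed.

Lemma encode_adm T : adm (encode T).
Proof.
move=> b /asboolP[c Mc Pb].
by have := pattern_adm (col := col) (n := code c) (v := T c) Mc Pb.
Qed.

Let encode_loc T T' b : (forall c, M c -> d b c <= rho -> T c = T' c) ->
  encode T b = encode T' b.
Proof.
move=> TT'; apply/asboolP/asboolP => -[c Mc Pb]; exists c => //; have := pat_dist Pb;
  by rewrite dC => cb; rewrite ?TT' // -?TT' //; lia.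
Qed.

Let encode_inv m q T T' b : k <= m -> Q m q -> d p b + (a1 + 2 * L) <= R m ->
  (forall c, d b c <= rho -> T' (h m q c) = T c) -> encode T' (h m q b) = encode T b.
Proof.
move=> km Qq pb TT'.
have L1 := sites_chart st Qq; have [_ dE su] := L1; have Rtm := Rt m.
have key c : d c b <= rho ->
    (M (h m q c) <-> M c) /\ pat (h m q c) (T' (h m q c)) (h m q b) = pat c (T c) b.
  move=> cb; have pc := tri b p c; rewrite (dC b c) in pc.
  rewrite (invM km Qq); last lia; split=> //.
  rewrite /pat (TT' c) ?(dC b c) // (codei km Qq); last lia.
  by apply: (pattern_inv coli) => //; lia.
apply/asboolP/asboolP => -[c Mc Pb]; have cb := pat_dist Pb; last first.
  have cb' : d c b <= rho by lia.
  by exists (h m q c); [exact: (key c cb').1.2|rewrite (key c cb').2].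
have qb : d q (h m q b) = d p b by rewrite (liso_dist L1) //; lia.
have [|c' pc' cE] := su c.
  by have := tri (h m q b) q c; rewrite (dC (h m q b) c); lia.
have cb' : d c' b <= rho.
  have := dE c' b; rewrite cE; lia.
by rewrite -cE in Mc Pb; exists c'; [exact: (key c' cb').1.1|rewrite -(key c' cb').2].
Qed.

Let Phi T := Psi (encode T).

(** The next level writes only outside the sites of level k, which stay as they are. *)
Let B' c := M c /\ forall q, Q k q -> R k < d q c.

Let suppM T : supp B' T -> forall x, T x <> None -> M x.
Proof. by move=> sT x /sT[]. Qed.

Let Mdens x : exists2 c, M c & d x c <= Kmax.
Proof.
have [[c Mc xc]|[c Mc xc]] := net_near hM x; exists c; by [left|right|lia].
Qed.

Let ring_carrier c r : exists2 b, B b & r < d c b <= r + 2 * s + 1.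
Proof.
have [y cy] := gdist_surj con deg inf c (r + s + 1).
have [b Bb yb] := Bd y; exists b => //.
by have := tri y c b; have := tri b c y; rewrite (dC b y); lia.
Qed.

(** The symbol of a root can be read off the bits in the two annuli around it, because
each annulus contains a carrier. *)
Let symbolE T c : M c ->
  (T c = Some false <-> exists2 b, 8 < d c b <= t1 & encode T b) /\
  (T c = Some true <-> exists2 b, t1 < d c b <= t2 & encode T b).
Proof.
move=> Mc; split; split.
- move=> Tc; have [b Bb cb] := ring_carrier c 8; exists b; first lia.
  rewrite (encodeE _ Mc); last lia.
  by apply/asboolP; split=> //; constructor 1; split=> //; lia.
- move=> [b cb]; rewrite (encodeE _ Mc); last lia.
  by move=> /asboolP[_ [[]|[]|[]]] //; lia.
- move=> Tc; have [b Bb cb] := ring_carrier c t1; exists b; first lia.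
  rewrite (encodeE _ Mc); last lia.
  by apply/asboolP; split=> //; constructor 2; split=> //; lia.
- move=> [b cb]; rewrite (encodeE _ Mc); last lia.
  by move=> /asboolP[_ [[]|[]|[]]] //; lia.
Qed.

Variables (lam' a' s' l' : nat).
Hypothesis hlam' : D4 + D2 + L + 20 <= lam'.
Hypothesis ha' : a1 + 4 * L <= a'.
Hypothesis hl' : l' = l + rho.
Hypothesis hs' : 2 * R k + 3 * Kmax + 1 <= s'.
Hypothesis hR : forall q, Q k q -> Fr k + l' + a' <= R k.
Hypothesis hS : forall q, Q k q -> 2 * Kmax + 1 <= S k.

Let rec_encode T T' x y f r u : ciso e (r + lam) x y f (Phi T) (Phi T') -> d x u <= r ->
  (M u <-> M (f u)) /\ encode T u = encode T' (f u).
Proof.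
move=> ff xu; apply: (pl_rec hP (encode_adm (T := T)) (encode_adm (T := T'))).
by apply: (ciso_restr con ff); lia.
Qed.

Let Phi_rec T T' x y f : supp B' T -> supp B' T' ->
  ciso e lam' x y f (Phi T) (Phi T') -> T x = T' y.
Proof.
move=> sT sT' ff; have [L1 _] := ff; have [fx dE su] := L1.
have ff' : ciso e (t2 + lam) x y f (Phi T) (Phi T') by apply: (ciso_le con ff); lia.
have [Mxy _] := rec_encode ff' (ltac:(by rewrite dxx) : d x x <= t2); rewrite fx in Mxy.
have [Mx|nMx] := pselect (M x); last first.
  have T0 : T x = None by apply: contrapT => /(suppM sT).
  have T0' : T' y = None.
    by apply: contrapT => /(suppM sT') /Mxy.
  by rewrite T0 T0'.
have My : M y by apply: Mxy.1.
have [F1 F2] := symbolE T Mx; have [F1' F2'] := symbolE T' My.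
have tr lo hi : hi <= t2 -> (exists2 b, lo < d x b <= hi & encode T b) <->
    (exists2 b, lo < d y b <= hi & encode T' b).
  move=> hi2; split=> -[b xb Eb].
    exists (f b); first by rewrite (liso_dist L1) //; lia.
    by rewrite -(rec_encode ff' _).2 //; lia.
  have [|b' xb' bE] := su b; first lia.
  rewrite -bE (liso_dist L1) // in xb; exists b' => //.
  by rewrite (rec_encode ff' _).2 ?bE //; lia.
have E1 : T x = Some false <-> T' y = Some false.
  by rewrite F1 F1'; apply: tr; lia.
have E2 : T x = Some true <-> T' y = Some true by rewrite F2 F2'; apply: tr.
case Tx : (T x) E1 E2 => [[]|]; case Ty : (T' y) => [[]|] // E1 E2.
- by have := E2.1 erefl.
- by have := E2.1 erefl.
- by have := E2.2 erefl.
- by have := E1.1 erefl.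
- by have := E2.2 erefl.
- by have := E1.2 erefl.
Qed.

(** The image of a root is a root of the same kind, as fatness depends only on the
ball; if it were different, it would be a competitor with isomorphic surroundings,
which the codes exclude. *)
Let fixed_root T T' x y f c : ciso e lam' x y f (Phi T) (Phi T') -> d x y < eps ->
  (Mf c /\ d x c <= D2) \/ (Mt c /\ d x c <= D3) -> f c = c.
Proof.
move=> ff xy cP; have [L1 _] := ff; have [fx dE su] := L1.
have Mc : M c by case: cP => -[]; [left|right].
have xc : d x c <= D2 by case: cP => -[]; lia.
have ff' : ciso e (D2 + L + lam) x y f (Phi T) (Phi T') by apply: (ciso_le con ff); lia.
have [Mfc _] := rec_encode ff' (ltac:(lia) : d x c <= D2 + L).
have {}Mfc := Mfc.1 Mc.
have dfc : d c (f c) <= 2 * d x c + d x y.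
  have := tri x c (f c); have := tri y x (f c); rewrite (liso_dist L1); last lia.
  by rewrite (dC c x); lia.
have cardE : #|` ball (f c) (rho - s)| = #|` ball c (rho - s)|.
  by apply: (card_ball_liso hG L1); lia.
apply: contrapT => ne; have co : conflict c (f c).
  split; first exact: nesym.
  case: cP => -[Mc1 xc1].
    left; split=> //; last lia.
    case: Mfc => // /(net_t hM)[_]; rewrite cardE.
    by have [_] := net_f hM Mc1; lia.
  right; split=> //; last lia.
  case: Mfc => // /(net_f hM)[_]; rewrite cardE.
  by have [_] := net_t hM Mc1; lia.
apply: (code_ok co); exists (T c), (T' (f c)), f; split.
  by apply: (liso_restr con L1); lia.
move=> u cu; have [_ colE] := ff.
have xu := tri c x u.
transitivity (Phi T' (f u)).
  apply: (pl_loc hP) => b ub; rewrite (encodeE T' Mfc) //.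
  have := tri (f u) (f c) b; rewrite dE; [|lia|lia].
  by lia.
rewrite colE; last lia.
apply: (pl_loc hP) => b ub; rewrite (encodeE T Mc) //.
by have := tri u c b; lia.
Qed.

Let Phi_inv m q x T T' : k <= m -> Q m q -> d p x + a' <= R m ->
  (forall u, d x u <= l' -> T' (h m q u) = T u) -> Phi T' (h m q x) = Phi T x.
Proof.
move=> km Qq px TT'; apply: (pl_inv hP) => //; first lia.
move=> u xu; apply: encode_inv => //; first by have := tri x p u; lia.
by move=> c uc; apply: TT'; have := tri u x c; lia.
Qed.

Lemma level_encode : level e R p Q h Fr k a' s' l' lam' eps B' Phi.
Proof.
split.
- move=> x.
  have [[q Qq qx]|far] := pselect (exists2 q, Q k q & d q x <= R k + Kmax); last first.
    have [c Mc xc] := Mdens x; exists c; last lia.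
    split=> // q Qq; rewrite ltnNge; apply/negP => qc; apply: far; exists q => //.
    by have := tri c q x; rewrite (dC c x); lia.
  have [z qz] := gdist_surj con deg inf q (R k + Kmax + 1).
  have [c Mc zc] := Mdens z; exists c; last first.
    have := tri q x z; have := tri z x c; rewrite (dC x q); lia.
  have qc : R k < d q c by have := tri c q z; rewrite (dC c z); lia.
  have qc' := tri z q c.
  split=> // q' Qq'.
  have [[_ <-] //|far|[]] := sites_dich st (leqnn _) Qq Qq'; last lia.
  by have := tri c q q'; rewrite (dC c q'); have := hS Qq; lia.
- move=> T T' x TT'; apply: (pl_loc hP) => u xu; apply: encode_loc => c Mc uc.
  by apply: TT'; have := tri u x c; lia.
- exact: Phi_rec.
- move=> T T' x y f sT sT' ff xy; have [[fx _ _] _] := ff; rewrite -fx; apply/esym.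
  apply: (pl_fin hP (encode_adm (T := T)) (encode_adm (T := T')) (y := y)).
  + by apply: (ciso_le con ff); lia.
  + by move=> c Mc xc; apply: (fixed_root ff xy); left.
  + by move=> c Mc xc; apply: (fixed_root ff xy); right.
- move=> m q x km Qq px; rewrite /B' (invM (ltnW km) Qq); last lia.
  have L1 := sites_chart st Qq; have [_ dE su] := L1; have Rtm := Rt m.
  have qx : d q (h m q x) = d p x by rewrite (liso_dist L1) //; lia.
  apply/propext; split=> -[Mx far]; split=> // u Qu; rewrite ltnNge; apply/negP => ux.
    have Qp := (sites_root st Qq).2.
    have [[? _]|far'|[_ nest]] := sites_dich st (ltnW km) Qp Qu; first lia.
      by have := tri x p u; rewrite (dC x u); lia.
    have := far (h m q u); rewrite (dE u x); [|lia|lia].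
    by rewrite -(sites_coh st km Qq nest) => /(_ Qu); lia.
  have [[? _]|far'|[_ nest]] := sites_dich st (ltnW km) Qq Qu; first lia.
    by have := tri (h m q x) q u; rewrite (dC (h m q x) u); lia.
  have [|v pv vE] := su u; first lia.
  have pv' : d p v = d q u by rewrite -vE (liso_dist L1).
  have Qv : Q k v by apply/(sites_coh st km Qq); rewrite ?pv' ?vE.
  have := far v Qv; rewrite -(dE v x) ?vE; lia.
- by move=> m q x T T' /ltnW; apply: Phi_inv.
- move=> m q x T; rewrite leq_eqVlt => /orP[/eqP mk|mk] Qq sT px; last first.
    exact: (pl_froz hP mk Qq (encode_adm (T := T)) px).
  subst m; have Rk := hR Qq; apply: Phi_inv => //; first lia.
  have T0 u q' : Q k q' -> d q' u <= R k -> T u = None.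
    by move=> Qq' qu; apply: contrapT => /sT[_ /(_ _ Qq')]; lia.
  move=> u xu; have pu : d p u <= R k by have := tri x p u; lia.
  rewrite (T0 u p (sites_root st Qq).2 pu) (T0 _ q) //.
  by rewrite (liso_dist (sites_chart st Qq)) //; have := Rt k; lia.
Qed.
End Encode.

Lemma level_exists lam' a' s' l' :
  D4 + D2 + L + 20 <= lam' -> a1 + 4 * L <= a' -> l' = l + rho ->
  2 * R k + 3 * Kmax + 1 <= s' ->
  (forall q, Q k q -> Fr k + l' + a' <= R k) ->
  (forall q, Q k q -> 2 * Kmax + 1 <= S k) ->
  exists B' Phi, level e R p Q h Fr (C := C) k a' s' l' lam' eps B' Phi /\
    forall T, exists2 P, adm P & Phi T = Psi P.
Proof.
move=> *; have [col [coli col_inj]] := col_ex.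
have [code [codei code_ok]] := code_exists coli col_inj.
do 2 eexists; split; first by apply: (level_encode coli codei code_ok).
move=> T; exists (encode col code T) => //; exact: encode_adm.
Qed.
End Code.

(** ** From one level to the roots of the next one *)

Section Step.
Variables (X : countType) (e : rel X) (Delta : nat).
Hypothesis hG : infinite_simple_graph e Delta.
Let sym : symmetric e. Proof. by case: hG. Qed.
Let con : connected_graph e. Proof. by case: hG. Qed.
Local Notation d := (gdist e).
Local Notation tri := (gdist_tri con).
Local Notation dC := (gdistC sym con).
Local Notation dxx := (gdistxx e).

Variables (N : nat) (R S t : nat -> nat) (p : X).
Variables (Q : nat -> X -> Prop) (h : nat -> X -> X -> X) (Fr : nat -> nat).
Hypothesis st : sites e N R S t p Q h.
Hypothesis Rt : forall m, R m <= t m.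
Local Notation invd := (invd e R p Q h).

Variables (C : Type) (k a0 a1 s l lam eps0 eps rho W L sig D3 G0 K0 K1 Kmax D2 G1 : nat).
Hypothesis hc : consts Delta s l lam eps rho W L sig D3 G0 K0 K1 Kmax D2 G1.
Let cL := c_L hc.
Let csig := c_sig hc.
Let cD3 := c_D3 hc.
Let cKm := c_Km hc.
Let cD2 := c_D2 hc.

Variables (B Mf Mt : X -> Prop) (Phi : (X -> option bool) -> X -> C).
Hypothesis hL : level e R p Q h Fr k a0 s l lam eps0 B Phi.
Hypothesis eps3 : 3 <= eps0.
Hypothesis hM : net e R p Q h k.+1 a0 B s sig K1 (rho - s) W Mf Mt.
Hypothesis a01 : a0 + K1 + l <= a1.
Local Notation M c := (Mf c \/ Mt c).
Local Notation adm := (adm e B (fun c => M c)).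

Let symb (P : X -> bool) x :=
  if `[< M x >] then Some true else if P x then Some false else None.

Let symb_supp P : adm P -> supp B (symb P).
Proof.
move=> aP x; rewrite /symb; case: asboolP => [[/(net_f hM)[]|/(net_t hM)[]] //|_].
by case: ifP => // /aP[].
Qed.

(** An isomorphism that fixes c fixes its neighbors, since it moves them by at most 2
and points at distance less than 3 are separated; this propagates along geodesics. *)
Let rigid T T' c f r u : supp B T -> supp B T' ->
  ciso e (r + lam) c c f (Phi T) (Phi T') -> d c u <= r -> f u = u.
Proof.
move=> sT sT' ff; have [L1 _] := ff; have [fc dE _] := L1.
have [n] := ubnP (d c u); elim: n u => // n IH u cn cr.
have [c0|c0] := posnP (d c u); first by rewrite -(gdist0 con c0).
have [v cv vu] := @gdist_between _ _ con c u (d c u).-1 ltac:(lia).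
have fv := IH v ltac:(lia) ltac:(lia).
have := dE v u ltac:(lia) ltac:(lia); rewrite fv => vfu.
have := tri v u (f u); rewrite (dC u v) => uu.
apply/esym/(lv_dist hL sT sT'); last by apply: leq_trans eps3; lia.
by apply: (ciso_restr con ff); lia.
Qed.

(** Roots and bits of level k + 1 are written as symbols on the carriers of level k. *)
Lemma prelevel_step : exists Psi, prelevel e R p Q h Fr k.+1 a1 l lam rho D2 D3
    (D2 + Kmax + L + 20) B Mf Mt Psi /\
  forall P, adm P -> exists2 T, supp B T & Psi P = Phi T.
Proof.
exists (fun P => Phi (symb P)); split; last first.
  by move=> P aP; exists (symb P) => //; apply: symb_supp.
have PM P x : adm P -> P x -> ~ M x.
  by move=> aP /aP[_ far] /far; rewrite dxx.
have rec P P' x y f : adm P -> adm P' -> ciso e lam x y f (Phi (symb P)) (Phi (symb P')) ->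
    (M x <-> M y) /\ P x = P' y.
  move=> aP aP' ff; have := lv_rec hL (symb_supp aP) (symb_supp aP') ff.
  rewrite /symb; case: asboolP => Mx; case: asboolP => My.
  - have Px : ~ P x by move=> /(PM _ _ aP).
    have Py : ~ P' y by move=> /(PM _ _ aP').
    by move=> _; split=> //; move/negP/negbTE: Px => ->; move/negP/negbTE: Py => ->.
  - by case: ifP.
  - by case: ifP.
  - by case: (P x); case: (P' y) => // _; split.
split.
- exact: rec.
- move=> P P' c f Mc aP aP' ff u cu.
  have fu := rigid (symb_supp aP) (symb_supp aP') ff cu.
  have [] : (M u <-> M (f u)) /\ P u = P' (f u); last by rewrite fu.
  by apply: rec => //; apply: (ciso_restr con ff); lia.
- move=> P P' x y f aP aP' ff ff1 ff2; have [L1 _] := ff.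
  have [c [fc xc]] : exists c, f c = c /\ d x c <= Kmax.
    have [[c Mc xc]|[c Mc xc]] := net_near hM x; exists c; (split; last lia).
      by apply: ff1 => //; lia.
    by apply: ff2 => //; lia.
  apply: (rigid (c := c) (r := Kmax) (symb_supp aP) (symb_supp aP')); last by rewrite dC.
  by rewrite -{2}fc; apply: (ciso_restr con ff); lia.
- move=> P P' x PP'; apply: (lv_loc hL) => u xu; by rewrite /symb PP'.
- move=> m q x P P' km Qq px PP'; apply: (lv_inv hL) => //; first lia.
  move=> u xu; have pu := tri x p u.
  by rewrite /symb (net_invf hM) ?(net_invt hM) ?PP' //; lia.
- by move=> m q x P mk Qq aP px; apply: (lv_froz hL) => //; apply: symb_supp.
Qed.
End Step.

(** * Level 0 *)

Section Base.
Variables (X : countType) (e : rel X) (Delta : nat).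
Hypothesis hG : infinite_simple_graph e Delta.
Let sym : symmetric e. Proof. by case: hG. Qed.
Let irr : irreflexive e. Proof. by case: hG. Qed.
Let con : connected_graph e. Proof. by case: hG. Qed.
Let inf : infinite_set [set: X]. Proof. by case: hG. Qed.
Let deg : degree_of_graph e Delta. Proof. by case: hG. Qed.
Local Notation d := (gdist e).
Local Notation tri := (gdist_tri con).
Local Notation dC := (gdistC sym con).
Local Notation dxx := (gdistxx e).
Local Notation ball := (ball e).
Let inB x r y : (y \in ball x r) = (d x y <= r) := in_ball con deg x r y.

Variables (N : nat) (R S t : nat -> nat) (p : X).
Variables (Q : nat -> X -> Prop) (h : nat -> X -> X -> X) (Fr : nat -> nat).
Hypothesis st : sites e N R S t p Q h.
Hypothesis Rt : forall m, R m <= t m.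
Hypothesis Rt10 : forall m, m <= N -> R m + 10 <= t m.
Hypothesis S2 : forall m, m <= N -> 2 <= S m.
Local Notation invd := (invd e R p Q h).

Let Delta_gt0 : 0 < Delta.
Proof.
have [y py] := gdist_surj con deg inf p 1.
apply: leq_trans (card_neighbors deg p); rewrite cardfs_gt0; apply/fset0Pn; exists y.
rewrite in_fset_set; last by case: deg => f _; apply: f.
exact/mem_set/gdist1.
Qed.

(** ** Root candidates *)

(** The twin u of a root c is the neighbor that gets the color 0 too, and the beacon v is
the vertex that tells c from u, being at distance 3 from c and 4 from u. *)

Let twin_candidate c u := e c u /\ exists2 v, d c v = 3 & d u v = 4.

Let twin_candidate_liso c c' f u : liso e 4 c c' f -> d c u <= 4 -> (twin_candidate c u <-> twin_candidate c' (f u)).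
Proof.
move=> L cu; have [fc dE su] := L; rewrite /twin_candidate -fc (liso_adj irr con L) ?dxx //.
split=> -[ed [v cv uv]]; split=> //.
  by exists (f v); rewrite dE ?dxx ?cv //; lia.
have [|v' cv' vE] := su v; first by rewrite -fc cv.
by exists v'; [rewrite -dE ?vE ?dxx|rewrite -dE ?vE].
Qed.

(** The second vertex of a geodesic of length 4 is a root candidate, the twin being its
first vertex and the beacon its last one. *)
Lemma root_candidates : exists B : X -> Prop,
  [/\ invd 0 0 B, forall x, exists2 b, B b & d x b <= 3,
      forall x y, B x -> B y -> d x y <= 2 -> x = y
    & forall c, B c -> exists u, e c u /\ exists2 v, d c v = 3 & d u v = 4].
Proof.
pose good c := exists u, twin_candidate c u.
have goodi : invd 0 0 good.
  move=> m q c _ Qq pc; have [mN _] := sites_root st Qq; have Rtm := Rt10 mN.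
  have L := sites_chart st Qq.
  have L4 : liso e 4 c (h m q c) (h m q) by apply: (liso_restr con L); lia.
  have [_ _ su] := L4.
  apply/propext; split=> -[u cu].
    have [|u' cu' uE] := su u; first by rewrite (gdist_adj irr con cu.1).
    by exists u'; apply/(twin_candidate_liso L4 cu'); rewrite uE.
  by exists (h m q u); apply/(twin_candidate_liso L4) => //; rewrite (gdist_adj irr con cu.1).
have [|B [B1 B2 B3 B4 _]] := maximal_separated hG st Rt (k := 0) (r := 2) _ goodi.
  by move=> m _; apply: S2.
exists B; split=> // x.
have [y xy] := gdist_surj con deg inf x 4.
have [c xc cy] := @gdist_between _ _ con x y 1 ltac:(lia).
have [|b Bb cb] := B3 c; last by exists b => //; have := tri c x b; lia.
exists x; split; first by rewrite sym; apply: gdist1.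
by exists y => //; lia.
Qed.

Section Col.
Variable col : X -> nat.
Hypothesis col_inj : forall x y, col x = col y -> d x y <= 10 -> x = y.

(** Choosing the least name is an invariant choice among the points of a small set. *)
Definition amin (A : X -> Prop) x := A x /\ forall y, A y -> col x <= col y.

Lemma amin_ex (A : X -> Prop) x : A x -> exists y, amin A y.
Proof.
move=> Ax; pose P n := exists2 y, A y & col y = n.
have [|y Ay yE] := @leastP P; first by exists (col x), x.
exists y; split=> // z Az; rewrite yE; apply: least_min; by exists z.
Qed.

Lemma amin_uniq (A : X -> Prop) x y : amin A x -> amin A y -> d x y <= 10 -> x = y.
Proof.
move=> [Ax mx] [Ay my] xy; apply: col_inj => //.
by have := mx _ Ay; have := my _ Ax; lia.
Qed.

Lemma amin_liso r x y f A A' z : liso e r x y f ->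
  (forall z, A z -> d x z <= r) -> (forall z, A' z -> d y z <= r) ->
  (forall z, d x z <= r -> (A z <-> A' (f z))) ->
  (forall z, d x z <= r -> col (f z) = col z) -> d x z <= r ->
  (amin A z <-> amin A' (f z)).
Proof.
move=> L Ar Ar' AA' ci xz; have [_ _ su] := L.
rewrite /amin (AA' z xz) ci //; split=> -[Az mn]; split=> // w Aw.
  have [w' xw' wE] := su w (Ar' _ Aw); rewrite -wE ci //; apply: mn.
  by apply/AA' => //; rewrite wE.
have xw := Ar _ Aw; rewrite -(ci w) //; apply: mn; exact: (AA' w xw).1.
Qed.

Definition twin_of c := amin (twin_candidate c).
Let beacon_candidate c v := d c v = 3 /\ exists2 u, twin_of c u & d u v = 4.
Definition beacon_of c := amin (beacon_candidate c).

Let twin_dist c u : twin_of c u -> d c u = 1.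
Proof. by move=> [[cu _] _]; apply: gdist_adj. Qed.
Let beacon_dist c u : beacon_of c u -> d c u = 3.
Proof. by move=> [[]]. Qed.

Let twin_uniq c u u' : twin_of c u -> twin_of c u' -> u = u'.
Proof.
move=> cu cu'; apply: (amin_uniq cu cu').
by have := tri c u u'; rewrite (dC u c) (twin_dist cu) (twin_dist cu'); lia.
Qed.

Let beacon_uniq c u u' : beacon_of c u -> beacon_of c u' -> u = u'.
Proof.
move=> cu cu'; apply: (amin_uniq cu cu').
by have := tri c u u'; rewrite (dC u c) (beacon_dist cu) (beacon_dist cu'); lia.
Qed.

Let twin_beacon_dist c u v : twin_of c u -> beacon_of c v -> d u v = 4.
Proof. by move=> cu [[_ [u' cu' <-]] _]; rewrite (twin_uniq cu cu'). Qed.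

Let twin_liso c c' f u : liso e 4 c c' f -> (forall z, d c z <= 4 -> col (f z) = col z) ->
  d c u <= 4 -> (twin_of c u <-> twin_of c' (f u)).
Proof.
move=> L ci cu; apply: (amin_liso L) => // z.
- by move=> [/(gdist_adj irr con) -> _].
- by move=> [/(gdist_adj irr con) -> _].
- exact: twin_candidate_liso.
Qed.

Let beacon_liso c c' f u : liso e 4 c c' f -> (forall z, d c z <= 4 -> col (f z) = col z) ->
  d c u <= 4 -> (beacon_of c u <-> beacon_of c' (f u)).
Proof.
move=> L ci cu; apply: (amin_liso L) => // z.
- by move=> [-> _].
- by move=> [-> _].
move=> cz; have [fc dE su] := L.
rewrite /beacon_candidate -fc dE ?dxx // fc; split=> -[cz' [v cv vz]]; split=> //.
  have cv4 : d c v <= 4 by rewrite (twin_dist cv).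
  by exists (f v); [apply/(twin_liso L ci)|rewrite dE].
have [|v' cv' vE] := su v; first by rewrite (twin_dist cv).
rewrite -vE in cv vz; exists v'; first by apply/(twin_liso L ci).
by rewrite -dE.
Qed.

(** ** Ranks *)

Variables (a1 s l lam eps rho W L sig D3 G0 K0 K1 Kmax D2 G1 : nat).
Hypothesis hc : consts Delta s l lam eps rho W L sig D3 G0 K0 K1 Kmax D2 G1.
Let cL := c_L hc.
Let csig := c_sig hc.
Let cD3 := c_D3 hc.
Let cG0 := c_G0 hc.
Let cK0 := c_K0 hc.
Let cK1 := c_K1 hc.
Let cKm := c_Km hc.
Let cD2 := c_D2 hc.
Let clam := c_lam hc.

Variables (B Mf Mt : X -> Prop).
Hypothesis Bsep : forall x y, B x -> B y -> d x y <= 2 -> x = y.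
Hypothesis Bcand : forall c, B c -> exists u, twin_candidate c u.
Hypothesis hM : net e R p Q h 0 0 B s sig K1 (rho - s) W Mf Mt.
Hypothesis coli : invd 0 0 col.
Hypothesis a1E : K1 + Kmax + 20 <= a1.
Local Notation M c := (Mf c \/ Mt c).
Local Notation adm := (adm e B (fun c => M c)).

Let sepM c c' : M c -> M c' -> d c c' <= sig -> c = c'.
Proof. exact: (net_sep hM). Qed.

Let MB c : M c -> B c.
Proof. by move=> [/(net_f hM)[]|/(net_t hM)[]]. Qed.

Let rk u j := (exists2 c, Mf c & d u c <= j) \/ (exists2 c, Mt c & K0 + d u c <= j).

(** The offset K0 makes fat roots prevail over thin ones: vertices within K0 of a fat root
are attached without any reference to thin roots. *)
Definition rank u := least (rk u).

Let rk_max u : rk u Kmax.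
Proof. by case: (net_near hM u) => -[c Mc uc]; [left|right]; exists c => //; lia. Qed.

Let rankP u : rk u (rank u).
Proof. by apply: leastP; exists Kmax. Qed.

Let rank_min u j : rk u j -> rank u <= j.
Proof. exact: least_min. Qed.

Let rank_max u : rank u <= Kmax.
Proof. exact: rank_min. Qed.

(** Around a root, ranks grow with the distance to this root, because all other roots
are far, or thin and penalized by K0. *)
Let rank_near c u : M c -> d c u <= L -> rank u = rank c + d c u.
Proof.
move=> Mc cu.
have far c' : M c' -> c' <> c -> sig < d c c'.
  by move=> Mc' ne; rewrite ltnNge; apply/negP => le; apply: ne; rewrite (sepM Mc Mc' le).
have uc' c' := tri u c c'.
have [cE|cE] : (Mf c /\ rank c = 0) \/ (Mt c /\ rank c = K0).
  case: Mc => Mc; [left|right]; split=> //.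
    by apply/eqP; rewrite -leqn0; apply: rank_min; left; exists c; rewrite ?dxx.
  apply/eqP; rewrite eqn_leq; apply/andP; split.
    by apply: rank_min; right; exists c => //; rewrite dxx; lia.
  case: (rankP c) => -[c' Mc' cc']; last lia.
  by have := net_ft hM Mc Mc'; lia.
- have [Mfc ->] := cE; apply/eqP; rewrite eqn_leq; apply/andP; split.
    by apply: rank_min; left; exists c => //; rewrite dC; lia.
  case: (rankP u) => -[c' Mc' uc]; last lia.
  have [cE'|ne] := eqVneq c' c; first by rewrite cE' (dC u c) in uc; lia.
  by have := far c' (or_introl Mc') (elimN eqP ne); have := uc' c'; lia.
- have [Mtc ->] := cE; apply/eqP; rewrite eqn_leq; apply/andP; split.
    by apply: rank_min; right; exists c => //; rewrite (dC u c); lia.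
  case: (rankP u) => -[c' Mc' uc].
    by have := net_ft hM Mtc Mc'; have := uc' c'; lia.
  have [cE'|ne] := eqVneq c' c; first by rewrite cE' (dC u c) in uc; lia.
  by have := far c' (or_intror Mc') (elimN eqP ne); have := uc' c'; lia.
Qed.

Let rank_thin c : Mt c -> rank c = K0.
Proof.
move=> Mc; apply/eqP; rewrite eqn_leq; apply/andP; split.
  by apply: rank_min; right; exists c => //; rewrite dxx; lia.
case: (rankP c) => -[c' Mc' cc']; last lia.
by have := net_ft hM Mc Mc'; lia.
Qed.

Let lower u : ~ M u -> exists v, e u v /\ rank v < rank u.
Proof.
move=> nM.
have step c : M c -> exists v, e u v /\ d v c = (d u c).-1 /\ 0 < d u c.
  move=> Mc; have c0 : 0 < d u c.
    by rewrite lt0n; apply/eqP => /(gdist0 con) uc; apply: nM; rewrite uc.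
  have [v uv vc] := @gdist_between _ _ con u c 1 c0.
  by exists v; split; [apply: gdist1|lia].
case: (rankP u) => -[c Mc uc].
  have [v [uv [vc c0]]] := step c (or_introl Mc); exists v; split=> //.
  apply: (@leq_ltn_trans (d u c).-1); last lia.
  by apply: rank_min; left; exists c => //; lia.
have [v [uv [vc c0]]] := step c (or_intror Mc); exists v; split=> //.
apply: (@leq_ltn_trans (K0 + (d u c).-1)); last lia.
by apply: rank_min; right; exists c => //; lia.
Qed.

Let rank_liso r x y f u : liso e r x y f ->
  (forall z, d x z <= r -> (Mf (f z) <-> Mf z) /\ (Mt (f z) <-> Mt z)) ->
  d x u + Kmax <= r -> rank (f u) = rank u.
Proof.
move=> Lf ff xu; have [_ dE su] := Lf; have ru := rank_max u; have rfu := rank_max (f u).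
have yu : d y (f u) = d x u by rewrite (liso_dist Lf) //; lia.
apply/eqP; rewrite eqn_leq; apply/andP; split; apply: rank_min.
  case: (rankP u) => -[c Mc uc]; have := tri u x c => xc; [left|right]; exists (f c);
    rewrite ?dE //; try lia.
    by apply/(ff c _).1 => //; lia.
  by apply/(ff c _).2 => //; lia.
case: (rankP (f u)) => -[c' Mc uc]; have := tri (f u) y c' => xc;
  (have [|c xc' cE] := su c'; first lia); subst c'; [left|right]; exists c.
- by apply/(ff c _).1.
- by rewrite -dE //; lia.
- by apply/(ff c _).2.
- by rewrite -dE //; lia.
Qed.

Let parent u v := amin (fun z => e u z /\ rank z < rank u) v.

Let parent_ex u : ~ M u -> exists v, parent u v.
Proof. by move=> /lower[v uv]; apply: (amin_ex (x := v)). Qed.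

(** ** The base coloring *)

Let Twin u := exists2 c, M c & twin_of c u.
Let Beacon u := exists2 c, M c & beacon_of c u.

Let twin_ex c : M c -> exists u, twin_of c u.
Proof. by move=> /MB /Bcand[u cu]; apply: (amin_ex cu). Qed.

Let beacon_ex c : M c -> exists u, beacon_of c u.
Proof.
move=> Mc; have [u cu] := twin_ex Mc; have [[_ [v cv uv]] _] := cu.
by apply: (@amin_ex _ v); split=> //; exists u.
Qed.

(** Twins get the color 0, so they do not compete with their siblings. *)
Let sib u w := [/\ ~ Twin u, ~ Twin w, u <> w & exists2 v, parent u v & parent w v].

Let sib_dist u w : sib u w -> d u w <= 2.
Proof.
move=> [_ _ _ [v [[uv _] _] [[wv _] _]]].
have := tri v u w; rewrite (gdist_adj irr con uv) (dC v w) (gdist_adj irr con wv); lia.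
Qed.

Let invM : invd 0 K1 (fun c => M c).
Proof. by move=> m q x km Qq px; rewrite (net_invf hM) ?(net_invt hM) //; lia. Qed.

Let col_chart m q c z : Q m q -> d p c + 4 <= R m -> d c z <= 4 -> col (h m q z) = col z.
Proof. by move=> Qq pc cz; apply: coli => //; have := tri c p z; lia. Qed.

Let chart4 m q c : Q m q -> d p c + 4 <= R m -> liso e 4 c (h m q c) (h m q).
Proof. by move=> Qq pc; apply: (chart_restr con st) => //; have := Rt m; lia. Qed.

Let marks_inv m q x : Q m q -> d p x + K1 + 10 <= R m -> (Twin (h m q x) <-> Twin x) /\ (Beacon (h m q x) <-> Beacon x).
Proof.
move=> Qq px; have Lx := chart4 Qq (ltac:(lia) : d p x + 4 <= R m).
have [_ dE su] := Lx.
have tr (cf : X -> X -> Prop) : (forall c u, cf c u -> d c u <= 4) ->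
   (forall c, d p c + 4 <= R m -> d c x <= 4 -> (cf c x <-> cf (h m q c) (h m q x))) ->
   (exists2 c, M c & cf c (h m q x)) <-> (exists2 c, M c & cf c x).
  move=> cfd cft; split=> -[c Mc cx]; have cd := cfd _ _ cx; have pc := tri x p c;
    rewrite dC in cd.
    have [|c' xc' cE] := su c; first by [].
    have pc' := tri x p c'; rewrite -cE in cx Mc.
    exists c'; first by rewrite -(invM (leq0n m) Qq (x := c')) //; lia.
    apply: (cft c' _ _).2 => //; rewrite ?(dC c') //; lia.
  exists (h m q c); first by rewrite (invM (leq0n m) Qq) //; lia.
  by apply: (cft c _ _).1 => //; rewrite ?(dC c) //; lia.
split; apply: tr.
- by move=> c u /twin_dist ->.
- by move=> c pc cx; apply: twin_liso => //; [exact: chart4|move=> z; apply: col_chart].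
- by move=> c u /beacon_dist ->.
- by move=> c pc cx; apply: beacon_liso => //; [exact: chart4|move=> z; apply: col_chart].
Qed.

Let rank_chart m q x : Q m q -> d p x + K1 + Kmax <= R m -> rank (h m q x) = rank x.
Proof.
move=> Qq px.
have Lp : liso e (R m - K1) p q (h m q).
  by apply: (liso_le con (sites_chart st Qq)); have := Rt m; lia.
apply: (rank_liso Lp); last lia.
by move=> z pz; rewrite (net_invf hM) ?(net_invt hM) //; lia.
Qed.

Let parent_chart m q u v : Q m q -> d p u + K1 + Kmax + 4 <= R m -> d u v <= 4 ->
  (parent u v <-> parent (h m q u) (h m q v)).
Proof.
move=> Qq pu uv; have Lu := chart4 Qq (ltac:(lia) : d p u + 4 <= R m).
apply: (amin_liso Lu) => // z.
- by move=> [/(gdist_adj irr con) -> _].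
- by move=> [/(gdist_adj irr con) -> _].
- move=> uz; have := tri u p z => pz.
  by rewrite (liso_adj irr con Lu) ?dxx // !rank_chart //; lia.
- by apply: col_chart => //; lia.
Qed.

Let sib_chart m q u w : Q m q -> d p u + K1 + Kmax + 10 <= R m ->
  d p w + K1 + Kmax + 10 <= R m -> (sib u w <-> sib (h m q u) (h m q w)).
Proof.
move=> Qq pu pw; rewrite /sib.
have C1u := (marks_inv Qq (ltac:(lia) : d p u + K1 + 10 <= R m)).1.
have C1w := (marks_inv Qq (ltac:(lia) : d p w + K1 + 10 <= R m)).1.
have uw : u = w <-> h m q u = h m q w.
  split=> [-> //|E]; apply: (gdist0 con); rewrite -(chart_dist st Rt Qq) ?E ?dxx //; lia.
have par u' v : parent u' v -> d u' v = 1 by move=> [[/(gdist_adj irr con)]].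
split=> -[nu nw ne [v uv wv]]; split; try tauto.
  have uv1 := par _ _ uv; have wv1 := par _ _ wv.
  exists (h m q v).
    by apply: (parent_chart Qq (u := u) (v := v) _ _).1 => //; lia.
  by apply: (parent_chart Qq (u := w) (v := v) _ _).1 => //; lia.
have [_ _ su] := chart4 Qq (ltac:(lia) : d p u + 4 <= R m).
have [|v' uv' vE] := su v; first by rewrite par.
subst v; exists v'.
  by apply: (parent_chart Qq (u := u) (v := v') _ _).2 => //; lia.
have := par _ _ wv; have [_ dE _] := sites_chart st Qq.
have := tri u p v' => pv; rewrite dE; [|have := Rt m; lia|have := Rt m; lia].
by move=> wv1; apply: (parent_chart Qq (u := w) (v := v') _ _).2 => //; lia.
Qed.

(** First-fit colors starting from 1.  A color is at most Delta - 1 because the parent has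
at most Delta neighbors, two of which do not count: the vertex itself, and the parent
of its parent or, if its parent is a root, the twin of this root. *)
Lemma base_exists : exists bc : X -> nat,
  [/\ forall u, 0 < bc u, forall u w, sib u w -> bc u <> bc w,
      invd 0 (K1 + Kmax + 10) bc
    & forall u, ~ M u -> ~ Twin u -> bc u < Delta].
Proof.
pose bad u (n : nat) w n' := sib u w /\ n = n'.
have [||||||F [F0 F1 F2 F3 _]] := @greedy _ e sym con N R S t p Q h st Rt 0
   (K1 + Kmax + 10) 2 (fun _ n => 0 < n) bad.
- by move=> m _; apply: S2.
- move=> u n w n' [[nu nw ne [v uv wv]] ->]; split=> //; split=> //; first exact: nesym.
  by exists v.
- by move=> u n w n' [sb _]; split; [case: sb|apply: sib_dist].
- move=> u g; exists (\max_(y <- ball u 2) g y).+1; split=> // w [/sib_dist uw].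
  have wB : w \in ball u 2 by rewrite inB.
  have : g w <= \max_(y <- ball u 2) g y by apply: leq_bigmax_seq.
  by move=> le nE; rewrite -nE ltnn in le.
- by [].
- by move=> m q u w n n' _ Qq pu pw; rewrite /bad -(sib_chart Qq) //; lia.
exists F; split=> //; first by move=> u w sb FE; apply: (F1 u w).
move=> u nM nC; have [v uv] := parent_ex nM; have [[euv rv] _] := uv.
have [z vz zsib] : exists2 z, e v z & z <> u /\ forall w, sib u w -> w <> z.
  have parE w : sib u w -> parent w v.
    move=> [_ _ _ [v' uv' wv']]; suff -> : v = v' by [].
    apply: (amin_uniq uv uv'); have [[eu' _] _] := uv'.
    have := tri u v v'; rewrite (dC v u) (gdist_adj irr con euv) (gdist_adj irr con eu'); lia.
  have [Mv|nMv] := pselect (M v).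
    have [z vz] := twin_ex Mv; exists z; first by have [[]] := vz.
    have C1z : Twin z by exists v.
    split=> [zu|w [_ nw _ _] wz]; first by rewrite zu in C1z.
    by rewrite wz in nw.
  have [z [vz rz]] := lower nMv; exists z => //; split=> [zu|w sw wz].
    by rewrite zu in rz; lia.
  by have [[_ +] _] := parE _ sw; rewrite wz; lia.
pose A := (fset_set (neighbors e v) `\ u `\ z)%fset.
have inN w : e v w -> w \in fset_set (neighbors e v).
  move=> vw; rewrite in_fset_set; last by case: deg => f _; apply: f.
  exact: mem_set.
have cardA : (#|` A|).+2 <= Delta.
  apply: leq_trans (card_neighbors deg v).
  rewrite (cardfsD1 u (fset_set (neighbors e v))) (inN u) ?(sym v) // (cardfsD1 z (_ `\ u)%fset) !inE.
  have -> : z != u by apply/eqP; have [] := zsib.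
  by rewrite (inN z vz) /= add1n add1n.
suff : #|` [fset n in iota 1 (F u).-1]%fset| <= #|` A|.
  rewrite card_fseq undup_id ?iota_uniq // size_iota; have := F0 u; lia.
apply: (card_inj (R := fun n w => sib u w /\ F w = n)) => [n|n n' w _ _ [_ <-] [_ <-]] //.
rewrite !inE mem_iota => nF; have [||w [sw Fw]] := F3 u n; try lia.
exists w; last by [].
have [_ _ ne [v' uv' wv']] := sw; have [_ zw] := zsib.
rewrite !inE; apply/and3P; split; [exact/eqP/zw|exact/eqP/nesym|].
apply: inN; have [[euv' _] _] := uv'; have [[ewv' _] _] := wv'.
rewrite sym; suff -> : v = v' by [].
apply: (amin_uniq uv uv').
have := tri u v v'; rewrite (dC v u) (gdist_adj irr con euv) (gdist_adj irr con euv'); lia.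
Qed.

Variable bc : X -> nat.
Hypothesis bc_gt0 : forall u, 0 < bc u.
Hypothesis bc_sib : forall u w, sib u w -> bc u <> bc w.
Hypothesis bc_inv : invd 0 (K1 + Kmax + 10) bc.
Hypothesis bc_lt : forall u, ~ M u -> ~ Twin u -> bc u < Delta.

Let zero (P : X -> bool) x := [\/ M x, Twin x, Beacon x | P x].
Let z0 : 'I_Delta := Ordinal Delta_gt0.
Let Psi (P : X -> bool) x : 'I_Delta := if `[< zero P x >] then z0 else insubd z0 (bc x).

Let PsiP P x : Psi P x = z0 <-> zero P x.
Proof.
rewrite /Psi; case: asboolP => // nz; split=> // /(congr1 val).
rewrite val_insubd bc_lt /=; [have := bc_gt0 x; lia| |].
  by move=> Mx; apply: nz; constructor 1.
by move=> Cx; apply: nz; constructor 2.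
Qed.

Let Psi_bc P P' u w : ~ zero P u -> ~ zero P' w -> Psi P u = Psi P' w -> bc u = bc w.
Proof.
rewrite /Psi => nu nw; case: asboolP => // _; case: asboolP => // _.
move=> /(congr1 val); rewrite !val_insubd !bc_lt //.
- by move=> Mx; apply: nw; constructor 1.
- by move=> Mx; apply: nw; constructor 2.
- by move=> Mx; apply: nu; constructor 1.
- by move=> Mx; apply: nu; constructor 2.
Qed.

(** Apart from the pair formed by a root and its twin, vertices of color 0 are at
distance at least 3, so no two siblings get the color 0. *)
Let zeros_far (P P' : X -> bool) x y : adm P -> adm P' -> [\/ Twin x, Beacon x | P x] ->
  [\/ Twin y, Beacon y | P' y] -> d x y <= 2 -> x = y.
Proof.
move=> aP aP' zx zy xy.
have C13 u : Twin u \/ Beacon u -> exists c, [/\ M c, d c u <= 3 & twin_of c u \/ beacon_of c u].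
  move=> [[c Mc cu]|[c Mc cu]]; exists c.
    by rewrite (twin_dist cu); split=> //; left.
  by rewrite (beacon_dist cu); split=> //; right.
have bit_far u w P1 : adm P1 -> Twin u \/ Beacon u -> P1 w -> 2 < d u w.
  move=> a1' /C13[c [Mc cu _]] /a1'[_ far].
  by have := far _ Mc; have := tri u c w; lia.
have marks : Twin x \/ Beacon x -> Twin y \/ Beacon y -> x = y.
  move=> /C13[c [Mc cx cx']] /C13[c' [Mc' cy cy']].
  have ? : c = c'.
    apply: sepM => //; have := tri x c c'; have := tri y x c'; rewrite (dC y c'); lia.
  subst c'; move: cx' cy' => [cx1|cx2] [cy1|cy2].
  - exact: twin_uniq cx1 cy1.
  - by rewrite (twin_beacon_dist cx1 cy2) in xy.
  - by rewrite dC (twin_beacon_dist cy1 cx2) in xy.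
  - exact: beacon_uniq cx2 cy2.
case: zx => zx; case: zy => zy; try (by apply: marks; tauto).
- by have := bit_far x y P' aP' (or_introl zx) zy; lia.
- by have := bit_far x y P' aP' (or_intror zx) zy; lia.
- by have := bit_far y x P aP (or_introl zy) zx; rewrite dC; lia.
- by have := bit_far y x P aP (or_intror zy) zx; rewrite dC; lia.
- by apply: Bsep => //; [have [] := aP _ zx|have [] := aP' _ zy].
Qed.

(** If v and v' are the parents of u and w, and if each of them is adjacent to both u and
w, then v = v', as each parent is the candidate of least name.  So u and w are siblings
with the same color. *)
Let siblings_rigid P P' u w v v' : adm P -> adm P' -> ~ M u -> ~ M w ->
  rank u = rank w -> parent u v -> parent w v' -> e w v -> e u v' ->
  Psi P u = Psi P' w -> u = w.
Proof.
move=> aP aP' nMu nMw rE uv wv' wv uv' co.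
have [[euv rv] mv] := uv; have [[ewv' rv'] mv'] := wv'.
have vE : v = v'.
  apply: col_inj; last first.
    by have := tri u v v'; rewrite (dC v u) (gdist_adj irr con euv) (gdist_adj irr con uv'); lia.
  have r1 : rank v' < rank u by rewrite rE.
  have r2 : rank v < rank w by rewrite -rE.
  by have := mv v' (conj uv' r1); have := mv' v (conj wv r2); lia.
subst v'; have uw : d u w <= 2.
  by have := tri v u w; rewrite (dC v w) (gdist_adj irr con euv) (gdist_adj irr con wv); lia.
have [zu|nzu] := pselect (zero P u).
  have zw : zero P' w by apply/PsiP; rewrite -co; apply/PsiP.
  apply: (zeros_far aP aP') => //.
    by case: zu => [/nMu//|?|?|?]; [constructor 1|constructor 2|constructor 3].
  by case: zw => [/nMw//|?|?|?]; [constructor 1|constructor 2|constructor 3].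
have nzw : ~ zero P' w by move=> /PsiP; rewrite -co => /PsiP.
apply: contrapT => ne; apply: (bc_sib (u := u) (w := w)); last exact: Psi_bc co.
split=> //; last by exists v.
  by move=> Cx; apply: nzu; constructor 2.
by move=> Cx; apply: nzw; constructor 2.
Qed.

Let near_root c u w : M c -> d c u <= 6 -> (M w \/ Twin w \/ Beacon w) -> d u w <= 4 ->
  [\/ w = c, twin_of c w | beacon_of c w].
Proof.
move=> Mc cu mw uw; have near c' : M c' -> d c' w <= 3 -> c' = c.
  move=> Mc' cw; apply: sepM => //.
  by have := tri w c' c; have := tri u w c; rewrite (dC w u) (dC u c); lia.
move: mw => [Mw|[[c' Mc' cw]|[c' Mc' cw]]].
- by constructor 1; apply: near; rewrite ?dxx.
- by constructor 2; rewrite -(near c') // (twin_dist cw).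
- by constructor 3; rewrite -(near c') // (beacon_dist cw).
Qed.

Let bit_near P c w : adm P -> M c -> P w -> 8 < d c w.
Proof. by move=> aP Mc /aP[_ far]; apply: far. Qed.

(** The twin has a neighbor of color 0 as well, namely the root, but all the other
vertices of color 0 are at distance at least 4 from it. *)
Let rootE P x : adm P -> (M x <-> [/\ zero P x, exists2 v, e x v & zero P v
  & exists2 w, d x w = 3 & zero P w]).
Proof.
move=> aP; split=> [Mx|[zx [v xv zv] [w xw zw]]].
  have [u xu] := twin_ex Mx; have [w xw] := beacon_ex Mx; split; first by constructor 1.
    exists u; first by have [[]] := xu.
    by constructor 2; exists x.
  exists w; first exact: beacon_dist xw.
  by constructor 3; exists x.
have xv1 := gdist_adj irr con xv.
have mark_far c y : M c -> d c y <= 8 -> zero P y -> M y \/ Twin y \/ Beacon y.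
  by move=> Mc cy [|||Py]; [tauto|tauto|tauto|have := bit_near aP Mc Py; lia].
case: zx => [//|[c Mc cx]|[c Mc cx]|Px].
- have cx1 := twin_dist cx.
  have cw := mark_far c w Mc ltac:(by have := tri x c w; lia) zw.
  have [wE|wE|wE] := near_root Mc (ltac:(have := tri x c w; lia) : d c w <= 6) cw (ltac:(by rewrite dxx)).
  + by rewrite wE dC cx1 in xw.
  + by rewrite (twin_uniq cx wE) dxx in xw.
  + by rewrite (twin_beacon_dist cx wE) in xw.
- have cx1 := beacon_dist cx.
  have cv := mark_far c v Mc ltac:(by have := tri x c v; lia) zv.
  have [vE|vE|vE] := near_root Mc (ltac:(have := tri x c v; lia) : d c v <= 6) cv (ltac:(by rewrite dxx)).
  + by rewrite vE dC cx1 in xv1.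
  + by rewrite dC (twin_beacon_dist vE cx) in xv1.
  + by rewrite (beacon_uniq cx vE) dxx in xv1.
- have zv' : [\/ Twin v, Beacon v | P v].
    case: zv => [Mv|Cv|Cv|Pv]; [|by constructor 1|by constructor 2|by constructor 3].
    by have := bit_near aP Mv Px; rewrite dC; lia.
  have xE : x = v by apply: (zeros_far aP aP) => //; [constructor 3|lia].
  by rewrite xE dxx in xv1.
Qed.

Let bitE P x : adm P -> (P x <-> [/\ zero P x, ~ (exists2 v, e x v & zero P v)
  & ~ (exists2 w, d x w = 3 & M w)]).
Proof.
move=> aP; split=> [Px|[zx nv nw]].
  split; first by constructor 4.
    move=> [v xv zv]; have xv1 := gdist_adj irr con xv.
    have zv' : [\/ Twin v, Beacon v | P v].
      case: zv => [Mv|Cv|Cv|Pv]; [|by constructor 1|by constructor 2|by constructor 3].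
      by have := bit_near aP Mv Px; rewrite dC; lia.
    have xE : x = v by apply: (zeros_far aP aP) => //; [constructor 3|lia].
    by rewrite xE dxx in xv1.
  by move=> [w xw Mw]; have := bit_near aP Mw Px; rewrite dC; lia.
case: zx => [Mx|[c Mc cx]|[c Mc cx]|//].
- have [u xu] := twin_ex Mx; case: nv; exists u; first by have [[]] := xu.
  by constructor 2; exists x.
- case: nv; exists c; last by constructor 1.
  by apply: (gdist1 con); rewrite (dC x c); apply: twin_dist cx.
- case: nw; exists c; last by [].
  by rewrite (dC x c); apply: beacon_dist cx.
Qed.

Let Psi_rec P P' x y f : adm P -> adm P' -> ciso e lam x y f (Psi P) (Psi P') ->
  (M x <-> M y) /\ P x = P' y.
Proof.
move=> aP aP' ff; have [Lf cf] := ff; have [fx dE su] := Lf.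
have zE u : d x u <= lam -> (zero P u <-> zero P' (f u)).
  by move=> xu; rewrite -!PsiP cf.
have tr u (A A' : X -> Prop) (i : nat) : d x u + i <= lam ->
    (forall v, d u v <= i -> (A v <-> A' (f v))) ->
    ((exists2 v, d u v = i & A v) <-> (exists2 v, d (f u) v = i & A' v)).
  move=> xu AA'; have Lu := liso_restr con Lf xu; have [_ dEu suu] := Lu.
  split=> -[v uv Av].
    exists (f v); last by apply/AA' => //; lia.
    by rewrite dEu ?dxx //; lia.
  have [|v' uv' vE] := suu v; first lia.
  subst v; exists v'; last by apply/AA'.
  by rewrite -uv dEu ?dxx.
have adjE' u (A : X -> Prop) : (exists2 v, e u v & A v) <-> (exists2 v, d u v = 1 & A v).
  by split=> -[v uv Av]; exists v => //; [apply: gdist_adj|apply: gdist1].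
have rE u : d x u + 3 <= lam -> (M u <-> M (f u)).
  move=> xu; rewrite (rootE u aP) (rootE (f u) aP').
  have z1 v : d u v <= 3 -> (zero P v <-> zero P' (f v)).
    by move=> uv; apply: zE; have := tri u x v; lia.
  have E1 := zE u ltac:(lia); have E2 := tr u _ _ 3 xu z1.
  have E3 := tr u (zero P) (zero P') 1 ltac:(lia) (fun v uv => z1 v ltac:(lia)).
  have E4 := adjE' u (zero P); have E5 := adjE' (f u) (zero P').
  by split=> -[? ? ?]; split; tauto.
split; first by rewrite -fx; apply: rE; rewrite dxx; lia.
suff : P x <-> P' y by move=> PE; apply/idP/idP; tauto.
rewrite (bitE x aP) (bitE y aP') -fx.
have E1 := zE x ltac:(rewrite dxx; lia).
have E2 := tr x (fun w => M w) (fun w => M w) 3 ltac:(rewrite dxx; lia)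
   (fun v xv => rE v ltac:(lia)).
have E3 := tr x (zero P) (zero P') 1 ltac:(rewrite dxx; lia) (fun v xv => zE v ltac:(lia)).
have E4 := adjE' x (zero P); have E5 := adjE' (f x) (zero P').
by split=> -[? ? ?]; split; tauto.
Qed.

(** Rigidity by induction on the rank: if w is the image of u, the parent of u and the
parent of w are fixed by the induction hypothesis, so [siblings_rigid] applies.  The
parent of w is within distance 3 of u, which is why the distance allowed grows by 3
when the rank decreases by 1. *)
Lemma base_prelevel : prelevel e R p Q h Fr 0 a1 0 lam rho D2 D3
  (D2 + Kmax + L + 20) B Mf Mt Psi.
Proof.
split.
- exact: Psi_rec.
- move=> P P' c f Mc aP aP' ff u cu; have [Lf cf] := ff; have [fc dE su] := Lf.
  have fixu : f u = u.
    have [n] := ubnP (d c u); elim: n u cu => // n IH u cr cn.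
    have [c0|c0] := posnP (d c u); first by rewrite -(gdist0 con c0).
    have dw : d c (f u) = d c u by rewrite (liso_dist Lf) //; lia.
    have nM w : d c w = d c u -> ~ M w.
      by move=> cw Mw; move: c0; rewrite -cw (sepM Mc Mw) ?dxx //; lia.
    have [v uv] := parent_ex (nM u erefl); have [v' wv'] := parent_ex (nM _ dw).
    have ru := rank_near Mc (ltac:(lia) : d c u <= L).
    have rw := rank_near Mc (ltac:(lia) : d c (f u) <= L).
    have par w z : parent w z -> d c w = d c u -> f z = z /\ d w z = 1.
      move=> [[wz rz] _] cw; have wz1 := gdist_adj irr con wz; split=> //.
      have cz : d c z <= d c u + 1 by have := tri w c z; lia.
      have := rank_near Mc (ltac:(lia) : d c z <= L).
      have := rank_near Mc (ltac:(lia) : d c w <= L).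
      by move=> rw1 rz1; apply: IH; lia.
    have [fv uv1] := par _ _ uv erefl; have [fv' wv1] := par _ _ wv' dw.
    have cv : d c v <= d c u + 1 by have := tri u c v; lia.
    have cv' : d c v' <= d c u + 1 by have := tri (f u) c v'; lia.
    apply/esym/(siblings_rigid aP aP' (nM _ erefl) (nM _ dw) _ uv wv'); first lia.
    - by apply: (gdist1 con); rewrite -{1}fv dE //; lia.
    - by apply: (gdist1 con); rewrite -wv1 -{2}fv' dE //; lia.
    - by rewrite cf //; lia.
  have [] : (M u <-> M (f u)) /\ P u = P' (f u); last by rewrite fixu.
  by apply: Psi_rec => //; apply: (ciso_restr con ff); lia.
- move=> P P' x y f aP aP' ff ff1 ff2; have [Lf cf] := ff; have [fx dE su] := Lf.
  have MfM z : d x z <= D2 + Kmax + 10 -> (M (f z) <-> M z).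
    move=> xz; have [H _] := Psi_rec aP aP' (ciso_restr con ff (ltac:(lia) : d x z + lam <= D2 + Kmax + L + 20)).
    by tauto.
  have cardE z : d x z <= D2 + Kmax + 10 -> #|` ball (f z) (rho - s)| = #|` ball z (rho - s)|.
    by move=> xz; apply: (card_ball_liso hG Lf); lia.
  have MtE z : d x z <= D2 + Kmax + 10 -> (Mf (f z) <-> Mf z) /\ (Mt (f z) <-> Mt z).
    move=> xz; have := MfM z xz; have := cardE z xz.
    have F c : Mf c -> ~ (#|` ball c (rho - s)| < W) by move=> /(net_f hM)[_]; lia.
    have T c : Mt c -> #|` ball c (rho - s)| < W by move=> /(net_t hM)[].
    have := F z; have := F (f z); have := T z; have := T (f z).
    move=> T1 T2 F1 F2 cE; rewrite cE in T1 F1; tauto.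
  have rE z : d x z <= D2 + 4 -> rank (f z) = rank z.
    move=> xz; have Lf' := liso_le con Lf (ltac:(lia) : D2 + Kmax + 10 <= D2 + Kmax + L + 20).
    by apply: (rank_liso Lf') => //; lia.
  suff claim n : forall u, rank u < n -> d x u + 3 * rank u <= 3 * Kmax -> f u = u.
    by apply: (claim (rank x).+1) => //; rewrite dxx; have := rank_max x; lia.
  elim: n => // n IH u rn xu.
  have [[Mu|Mu]|nMu] := pselect (M u).
  + by apply: ff1 => //; lia.
  + by apply: ff2 => //; have := rank_thin Mu; lia.
  have nMw : ~ M (f u) by rewrite MfM //; lia.
  have [v uv] := parent_ex nMu; have [v' wv'] := parent_ex nMw.
  have [[euv rv] _] := uv; have [[ewv' rv'] _] := wv'.
  have uv1 := gdist_adj irr con euv; have wv1 := gdist_adj irr con ewv'.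
  have ru := rE u ltac:(lia).
  have xv := tri u x v.
  have fv : f v = v by apply: IH; lia.
  have vw1 : d v (f u) = 1 by rewrite -{1}fv dE ?(dC v) //; lia.
  have xv' : d x v' <= d x u + 3.
    by have := tri v x v'; have := tri (f u) v v'; lia.
  have fv' : f v' = v' by apply: IH; lia.
  apply/esym/(siblings_rigid aP aP' nMu nMw _ uv wv'); first by rewrite ru.
  + by apply: (gdist1 con); rewrite dC.
  + by apply: (gdist1 con); rewrite -wv1 -{2}fv' dE //; lia.
  + by rewrite cf //; lia.
- move=> P P' x PP'; rewrite /Psi; congr (if _ then _ else _).
  by rewrite /zero PP' ?dxx.
- move=> m q x P P' _ Qq px PP'; rewrite /Psi bc_inv //; last lia.
  congr (if _ then _ else _); apply: asbool_equiv_eq.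
  have [C1E C2E] := marks_inv Qq (ltac:(lia) : d p x + K1 + 10 <= R m).
  rewrite /zero (invM (leq0n m) Qq) ?PP' ?dxx //; last lia.
  by split=> -[H|H|H|H]; by [constructor 1|constructor 2; tauto|constructor 3; tauto|constructor 4].
- by [].
Qed.
End Col.

Lemma prelevel_base a1 s lam eps rho W L sig D3 G0 K0 K1 Kmax D2 G1 (B Mf Mt : X -> Prop) :
  consts Delta s 0 lam eps rho W L sig D3 G0 K0 K1 Kmax D2 G1 ->
  (forall x y, B x -> B y -> d x y <= 2 -> x = y) ->
  (forall c, B c -> exists u, e c u /\ exists2 v, d c v = 3 & d u v = 4) ->
  net e R p Q h 0 0 B s sig K1 (rho - s) W Mf Mt ->
  (forall m, m <= N -> 10 <= S m) -> K1 + Kmax + 20 <= a1 ->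
  exists Psi : (X -> bool) -> X -> 'I_Delta,
    prelevel e R p Q h Fr 0 a1 0 lam rho D2 D3 (D2 + Kmax + L + 20) B Mf Mt Psi.
Proof.
move=> hc Bsep Bcand hM S10 a1E.
have [col [coli col_inj]] := local_naming hG st Rt (k := 0) (r := 10) 0 (fun m _ => @S10 m).
have [bc [bc0 bcs bci bcl]] := base_exists col_inj hc Bcand hM coli a1E.
by eexists; apply: (base_prelevel col_inj hc Bsep Bcand hM coli a1E bc0 bcs bci bcl).
Qed.
End Base.

(** * The numbers *)

Lemma power_beaten a b c : exists m, c <= m /\ 3 * (a * m + b) ^ 30 <= 2 ^ m.
Proof.
pose u := 100 + 30 * (a + b) + c; pose v := u + u.
have lin n : n < 2 ^ n by apply: ltn_expl.
have big : 30 * (a + b + v) + 2 + c <= 2 ^ v.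
  apply: (@leq_trans ((u.+1) * (u.+1))); last by rewrite /v expnD leq_mul ?lin.
  have : 100 * u <= u * u by rewrite leq_mul2r /u; lia.
  rewrite /v; have : 30 * (a + b) + c <= u by rewrite /u; lia.
  lia.
exists (2 ^ v); split; first lia.
have le : a * 2 ^ v + b <= 2 ^ (a + b + v).
  apply: (@leq_trans ((a + b) * 2 ^ v)).
    by rewrite mulnDl leq_add2l leq_pmulr // expn_gt0.
  by rewrite expnD leq_mul2r (ltnW (lin _)) orbT.
apply: (@leq_trans (2 ^ (2 + (a + b + v) * 30))).
  rewrite expnD expnM leq_mul // leq_exp2r //.
by rewrite leq_exp2l //; lia.
Qed.

Lemma W_affine V c v m t K :
  (V * (c * (v * m) + K) + 2 + t) * v = V * c * v * v * m + (V * K + 2 + t) * v.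
Proof.
rewrite (mulnDr V) -!addnA mulnDl; congr (_ + _).
by rewrite -!mulnA (mulnC m v).
Qed.

Lemma expn_le_exp2 V G : V ^ G <= 2 ^ (V * G).
Proof.
rewrite expnM; have [->|G0] := posnP G; first by rewrite !expn0.
by rewrite leq_exp2r // ltnW // ltn_expl.
Qed.

Record numbers := Numbers { n_rho : nat; n_W : nat; n_L : nat; n_sig : nat; n_D3 : nat;
  n_G0 : nat; n_K0 : nat; n_K1 : nat; n_Kmax : nat; n_D2 : nat; n_G1 : nat }.

Definition numbers_ok Delta s l lam eps (n : numbers) :=
  consts Delta s l lam eps (n_rho n) (n_W n) (n_L n) (n_sig n) (n_D3 n) (n_G0 n)
    (n_K0 n) (n_K1 n) (n_Kmax n) (n_D2 n) (n_G1 n).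

(** If rho is affine in m, so are G1 and the value of W that the fat condition dictates;
the thin condition then follows from 3 * W ^ 30 <= 2 ^ m. *)
Lemma numbers_exist Delta s l lam eps : exists n, 10 <= lam -> numbers_ok Delta s l lam eps n.
Proof.
pose vs := Delta.+1 ^ s; pose vt := Delta.+1 ^ (4 * s + 10).
pose K := 180 * (s + vs * vt + lam + l) + 7 * eps + 60 * s + 1000.
have vs0 : 0 < vs by rewrite expn_gt0.
pose A := Delta.+1 * 180 * vs * vs.
pose Bc := (Delta.+1 * K + 2 + vt) * vs.
have [m [cm mW]] := power_beaten A Bc (24 * (lam + l) + 66 * s + 120 + eps + 4 * s + 10).
pose rho := vs * (m + vt) + s.
pose L := rho + lam + l. pose sig := 2 * L + 20. pose D3 := 3 * (2 * L + s + sig).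
pose G0 := eps + 2 * D3. pose K0 := G0 + sig + s. pose K1 := K0 + 2 * L.
pose Kmax := K1 + s + sig. pose D2 := 3 * Kmax. pose G1 := eps + 2 * D2.
pose W := (Delta.+1 * G1 + 2 + vt) * vs.
have rm : m + s <= rho.
  rewrite /rho leq_add2r; apply: leq_trans (leq_pmull _ vs0).
  exact: leq_addr.
have WE : W <= A * m + Bc.
  have G1E : G1 <= 180 * (vs * m) + K.
    rewrite /K /G1 /D2 /Kmax /K1 /K0 /G0 /D3 /sig /L /rho (mulnDr vs); clear.
    by move: (vs * m) (vs * vt) => x y; lia.
  apply: (@leq_trans ((Delta.+1 * (180 * (vs * m) + K) + 2 + vt) * vs)); last first.
    by rewrite W_affine.
  by rewrite leq_mul2r !leq_add2r leq_mul2l G1E !orbT.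
exists (Numbers rho W L sig D3 G0 K0 K1 Kmax D2 G1) => lam10; split=> //=.
- move: cm rm; clear; move: rho => r; lia.
- rewrite /G0 /D3 /sig /L; move: cm rm; clear; move: rho => r; lia.
- move=> w; rewrite /rho addnK mulnC ltn_pmul2r // ltn_add2r => mw.
  apply: (@leq_ltn_trans (2 ^ m)); last by rewrite ltn_exp2l.
  apply: leq_trans mW; rewrite leq_mul2l /= leq_exp2r //.
- move=> w; rewrite /W leq_pmul2r // leq_add2r => Gw.
  apply: (@leq_trans (4 * Delta.+1 ^ G1)).
    by rewrite ltn_pmul2r // expn_gt0.
  apply: (@leq_trans (2 ^ (Delta.+1 * G1 + 2))); last by rewrite leq_exp2l.
  by rewrite expnD mulnC leq_mul2r expn_le_exp2 orbT.
Qed.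

(** The constants that a level hands over to the next one: the density of its carriers,
the locality of its coloring, the radius at which it can be read, the margin at which it
is chart invariant, the radii R, S, t of the sites, the number r_n of the theorem and the
sum r_0 + ... + r_n. *)
Record scale := Scale { sc_dens : nat; sc_loc : nat; sc_iso : nat; sc_marg : nat; sc_R : nat;
  sc_S : nat; sc_t : nat; sc_r : nat; sc_sum : nat }.

Definition numbers_of Delta s l lam eps : numbers :=
  projT1 (cid (numbers_exist Delta s l lam eps)).

Lemma numbers_ofP Delta s l lam eps : 10 <= lam ->
  numbers_ok Delta s l lam eps (numbers_of Delta s l lam eps).
Proof. by rewrite /numbers_of; case: cid. Qed.

Definition scale0 := Scale 3 0 10 0 0 0 0 0 0.

Definition next_scale Delta eps c :=
  let n := numbers_of Delta (sc_dens c) (sc_loc c) (sc_iso c) eps in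
  let a := sc_marg c + n_K1 n + n_Kmax n + sc_loc c + 5 * n_L n + 20 in
  let l := sc_loc c + n_rho n in
  let r := sc_r c + sc_R c + sc_S c + 1 in
  let RR := sc_sum c + r in
  let R := RR + l + a in
  Scale (2 * R + 3 * n_Kmax n + 1) l (2 * n_D2 n + n_Kmax n + 2 * n_L n + 40) a R
    (n_G1 n + 2 * n_Kmax n + 2 * sc_R c + sc_S c + 20) (R + sc_t c + n_rho n + 10) r RR.

(** Separating points at distance less than 3 is what makes the next level rigid. *)
Definition eps3 (eps : nat -> nat) k := maxn (eps k) 3.

Fixpoint scales Delta eps k := next_scale Delta (eps3 eps k)
  (if k is k'.+1 then scales Delta eps k' else scale0).

Definition prev_scale Delta eps k := if k is k'.+1 then scales Delta eps k' else scale0.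

Lemma scalesE Delta eps k : scales Delta eps k = next_scale Delta (eps3 eps k) (prev_scale Delta eps k).
Proof. by case: k. Qed.

Lemma eq_scales Delta eps eps' k : (forall i, i <= k -> eps i = eps' i) ->
  scales Delta eps k = scales Delta eps' k.
Proof.
elim: k => [|k IH] E; first by rewrite /= /eps3 E.
by rewrite /= IH => [|i ik]; [rewrite /eps3 E|apply: E; lia].
Qed.

Section Scales.
Variables (Delta : nat) (eps : nat -> nat).
Local Notation sc := (scales Delta eps).
Local Notation num k := (numbers_of Delta (sc_dens (prev_scale Delta eps k))
  (sc_loc (prev_scale Delta eps k)) (sc_iso (prev_scale Delta eps k)) (eps3 eps k)).

Lemma sc_iso_ge k : 10 <= sc_iso (prev_scale Delta eps k).
Proof. by case: k => [|k] //=; case: k => [|k] /=; lia. Qed.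

Lemma num_ok k : numbers_ok Delta (sc_dens (prev_scale Delta eps k)) (sc_loc (prev_scale Delta eps k))
  (sc_iso (prev_scale Delta eps k)) (eps3 eps k) (num k).
Proof. exact/numbers_ofP/sc_iso_ge. Qed.

Lemma scale_growth j m : j < m ->
  [/\ sc_R (sc j) + sc_S (sc j) <= sc_R (sc m),
      2 * sc_R (sc j) + sc_S (sc j) <= sc_S (sc m)
    & sc_R (sc m) + sc_t (sc j) <= sc_t (sc m)].
Proof.
elim: m => // m IH; rewrite ltnS leq_eqVlt => /orP[/eqP->|/IH[]];
  rewrite (scalesE _ _ m.+1) /=; first by split; lia.
by split; lia.
Qed.

Lemma scale_S j m : j <= m -> sc_S (sc j) <= sc_S (sc m).
Proof. by rewrite leq_eqVlt => /orP[/eqP->//|/scale_growth[]]; lia. Qed.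

Lemma scale_S_ge m : m <= sc_S (sc m).
Proof. by elim: m => // m IH; rewrite scalesE /=; lia. Qed.

Lemma scale_t k m rho : k <= m -> rho <= n_rho (num k) + 10 ->
  sc_R (sc m) + rho <= sc_t (sc m).
Proof.
move=> km rk; have tk : sc_R (sc k) + rho <= sc_t (sc k) by rewrite scalesE /=; lia.
move: km; rewrite leq_eqVlt => /orP[/eqP <- //|/scale_growth[_ _]].
lia.
Qed.

Lemma sc_sumE n : sc_sum (sc n) = \sum_(i < n.+1) sc_r (sc i).
Proof.
elim: n => [|n IH]; first by rewrite big_ord_recl big_ord0 addn0 scalesE.
by rewrite big_ord_recr /= -IH.
Qed.

Lemma sc_r_ge n : n < sc_r (sc n).
Proof. by elim: n => [|n IH]; rewrite scalesE /=; lia. Qed.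

Lemma sc_r_mono m n : m <= n -> sc_r (sc m) <= sc_r (sc n).
Proof.
by elim: n => [|n IH]; [case: m|rewrite leq_eqVlt => /orP[/eqP->//|/IH]; rewrite (scalesE _ _ n.+1) /=; lia].
Qed.

(** * All levels *)

Variables (X : countType) (e : rel X).
Hypothesis hG : infinite_simple_graph e Delta.
Local Notation d := (gdist e).
Variables (N : nat) (p : X) (Q : nat -> X -> Prop) (h : nat -> X -> X -> X).
Let R m := sc_R (sc m).
Let S m := sc_S (sc m).
Let t m := sc_t (sc m).
Let Fr m := sc_sum (sc m).
Hypothesis st : sites e N R S t p Q h.

Let Rt m : R m <= t m.
Proof. by have := @scale_t 0 m 0 (leq0n m) (leq0n _); rewrite addn0. Qed.

Definition separates (phi : X -> 'I_Delta) j := forall x y f,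
  ciso e (sc_iso (sc j)) x y f phi phi -> d x y < eps3 eps j -> x = y.

Let GS j m : j <= m -> n_G1 (num j) + 2 * n_Kmax (num j) + 20 <= S m.
Proof. by move=> /scale_S; apply: leq_trans; rewrite (scalesE _ _ j) /=; lia. Qed.

(** Codes are written on top of a given pre-level; the separation at the
lower levels is not affected, since it holds for all choices of the bits. *)
Lemma level_from_prelevel k (B Mf Mt : X -> Prop) Psi a0 a1 : let n := num k in
  let c := prev_scale Delta eps k in
  (forall x, exists2 b, B b & d x b <= sc_dens c) -> invd e R p Q h k a0 B ->
  net e R p Q h k a0 B (sc_dens c) (n_sig n) (n_K1 n) (n_rho n - sc_dens c) (n_W n) Mf Mt ->
  a0 <= sc_marg c -> a1 = sc_marg c + n_K1 n + n_Kmax n + sc_loc c + 20 ->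
  prelevel e R p Q h Fr k a1 (sc_loc c) (sc_iso c) (n_rho n) (n_D2 n) (n_D3 n)
    (n_D2 n + n_Kmax n + n_L n + 20) B Mf Mt Psi ->
  (forall P, adm e B (fun c => Mf c \/ Mt c) P -> forall j, j < k -> separates (Psi P) j) ->
  exists B Phi,
  level e R p Q h Fr k (sc_marg (sc k)) (sc_dens (sc k)) (sc_loc (sc k)) (sc_iso (sc k)) (eps3 eps k) B Phi /\
  forall T, supp B T -> forall j, j <= k -> separates (Phi T) j.
Proof.
move=> n c Bd Bi hM a0a a1E hP sepP.
have E := scalesE Delta eps k; rewrite -/c in E.
have a01 : a0 + n_K1 n <= a1 by lia.
have GS1 m : k <= m -> m <= N -> n_G1 n <= S m.
  by move=> km _; have := GS km; rewrite -/n; lia.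
have [||||||B' [Phi [hL PE]]] := level_exists hG st Rt (num_ok k) Bd Bi hM hP a01 GS1
   (lam' := sc_iso (sc k)) (a' := sc_marg (sc k)) (s' := sc_dens (sc k)) (l' := sc_loc (sc k)).
- by rewrite E /= -/n; lia.
- by rewrite E /= -/n; lia.
- by rewrite E.
- by rewrite E /= /R E /=.
- by move=> q _; rewrite /Fr /R E /= -/n; lia.
- by move=> q _; rewrite /S E /= -/n; lia.
exists B', Phi; split=> // T sT j; rewrite leq_eqVlt => /orP[/eqP-> x y f ff xy|jk].
  exact: (lv_dist hL sT sT ff xy).
by have [P aP ->] := PE T; apply: sepP.
Qed.

Let net_at k a0 (B : X -> Prop) : let n := num k in let c := prev_scale Delta eps k in
  (forall x, exists2 b, B b & d x b <= sc_dens c) -> invd e R p Q h k a0 B ->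
  exists Mf Mt,
    net e R p Q h k a0 B (sc_dens c) (n_sig n) (n_K1 n) (n_rho n - sc_dens c) (n_W n) Mf Mt.
Proof.
move=> n c Bd Bi; have ok := num_ok k; rewrite -/n -/c in ok.
have KE := c_K1 ok; have KE0 := c_K0 ok; have KmE := c_Km ok.
apply: (net_exists hG st Rt) => //.
- by move=> m km _; have := GS km; rewrite -/n; lia.
- by move=> m km _; apply: scale_t km _; rewrite -/n -/c; lia.
- by lia.
Qed.

Lemma levels k : exists B Phi,
  level e R p Q h Fr k (sc_marg (sc k)) (sc_dens (sc k)) (sc_loc (sc k)) (sc_iso (sc k)) (eps3 eps k) B Phi /\
  forall T, supp B T -> forall j, j <= k -> separates (Phi T) j.
Proof.
elim: k => [|k [B [Phi [hL sep]]]].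
  have Rt10 m : m <= N -> R m + 10 <= t m by move=> _; apply: (@scale_t 0 m 10 (leq0n m) (leq_addl _ _)).
  have S10 m : m <= N -> 10 <= S m by move=> _; have := GS (leq0n m); lia.
  have S2 m : m <= N -> 2 <= S m by move=> /S10; lia.
  have [B [Bi Bd Bsep Bc]] := root_candidates hG st Rt Rt10 S2.
  have [Mf [Mt hM]] := @net_at 0 0 B Bd Bi.
  have a1E : n_K1 (num 0) + n_Kmax (num 0) + 20 <=
      sc_marg scale0 + n_K1 (num 0) + n_Kmax (num 0) + sc_loc scale0 + 20 by rewrite /=; lia.
  have [Psi hP] := prelevel_base hG Fr st Rt S2 (num_ok 0) Bsep Bc hM S10 a1E.
  have H := @level_from_prelevel 0 B Mf Mt Psi 0 _ Bd Bi hM (leq0n _) (erefl _) hP.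
  by apply: H.
have Bd := lv_dens hL; have Bi := lv_invB hL.
have [Mf [Mt hM]] := @net_at k.+1 _ B Bd Bi.
have e3 : 3 <= eps3 eps k by rewrite /eps3; lia.
have [|Psi [hP PE]] := prelevel_step hG (num_ok k.+1) hL e3 hM
  (a1 := sc_marg (sc k) + n_K1 (num k.+1) + n_Kmax (num k.+1) + sc_loc (sc k) + 20).
  by rewrite /=; lia.
have H := @level_from_prelevel k.+1 B Mf Mt Psi _ _ Bd Bi hM (leqnn _) (erefl _) hP.
apply: H => P aP j jk.
by have [T sT ->] := PE P aP; apply: sep.
Qed.
End Scales.

Section Repetition.
Variables (X : countType) (e : rel X) (Delta : nat).
Hypothesis hG : infinite_simple_graph e Delta.
Let sym : symmetric e. Proof. by case: hG. Qed.
Let con : connected_graph e. Proof. by case: hG. Qed.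
Local Notation d := (gdist e).
Local Notation tri := (gdist_tri con).
Local Notation dC := (gdistC sym con).
Local Notation dxx := (gdistxx e).
Variables (N : nat) (R S t : nat -> nat) (p : X).
Hypothesis gR : forall j m, j < m -> R j + S j <= R m.
Hypothesis gS : forall j m, j < m -> 2 * R j + S j <= S m.
Hypothesis gt : forall j m, j < m -> R m + t j <= t m.
Hypothesis Rt : forall m, R m <= t m.
Local Notation sites := (sites e N R S t p).

(** * Construction and density of the sites *)

(** A new site of level j must not come near the boundary of a larger site. *)
Definition clear (Q : nat -> X -> Prop) j x :=
  forall m q, Q m q -> R m + (R j + S j) < d q x \/ d q x + (R j + S j) <= R m.

Definition repeats j x := exists f, liso e (t j) p x f.

(** The new sites are a maximal separated set of clear repetitions of D(p, t j), chosen
invariantly.  The chart of a new site is the chosen chart of its representative,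
followed by the chart of the smallest larger site that contains it. *)
Lemma add_sites j (Q : nat -> X -> Prop) (h : nat -> X -> X -> X) : j <= N ->
  sites Q h -> (forall m q, Q m q -> j < m) -> (forall m, j < m -> m <= N -> Q m p) ->
  exists (I : X -> Prop) (H : X -> X -> X),
    [/\ sites (fun m => if m == j then I else Q m) (fun m => if m == j then H else h m),
        I p
      & forall x, repeats j x -> clear Q j x ->
          exists2 q, I q & d x q <= 2 * R j + S j].
Proof.
move=> jN st Qj Qp.
pose elig x := repeats j x /\ clear Q j x.
(* charts preserve clearance: the other sites are either far from the chart
   or nested in it, hence transported by coherence *)
have eligi : invd e R p Q h j.+1 0 elig.
  move=> m q x jm Qq; rewrite addn0 => px; have L := sites_chart st Qq.
  have [_ dE su] := L; have Rtm := Rt m; have tjm := gt jm.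
  have Lx : liso e (t j) x (h m q x) (h m q) by apply: (liso_restr con L); lia.
  have Sm := gS jm; have qx : d q (h m q x) = d p x by rewrite (liso_dist L) //; lia.
  have QpM := (sites_root st Qq).2.
  apply/propext; split=> -[[f Lf] cl]; split.
  - have [g [Lg _ _]] := liso_inv con Lx; exists (g \o f); exact: (liso_comp Lf Lg).
  - move=> m' q' Qq'; have jm' := Qj _ _ Qq'; have Sm' := gS jm'.
    have [lt|gt'|eq] := ltngtP m' m; last first.
    + subst m'; have [[_ <-]|far|[]] := sites_dich st (leqnn _) QpM Qq'; last lia.
        by have := cl m q Qq; rewrite qx; lia.
      by left; have := tri x p q'; rewrite (dC x q'); lia.
    + have [[? _]|far|[_ le]] := sites_dich st (ltnW gt') Qq' QpM; first lia.
        by left; have := tri x q' p; rewrite (dC x p); lia.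
      by right; have := tri p q' x; lia.
    + have [[? _]|far|[_ le]] := sites_dich st (ltnW lt) QpM Qq'; first lia.
        by left; have := tri x p q'; rewrite (dC x q'); lia.
      have Qh : Q m' (h m q q') by apply/(sites_coh st lt Qq le).
      have := cl m' _ Qh; rewrite dE; lia.
  - exists (h m q \o f); exact: (liso_comp Lf Lx).
  - move=> m' q' Qq'; have jm' := Qj _ _ Qq'; have Sm' := gS jm'.
    have [lt|gt'|eq] := ltngtP m' m; last first.
    + subst m'; have [[_ <-]|far|[]] := sites_dich st (leqnn _) Qq Qq'; last lia.
        by have := cl m p QpM; rewrite qx; lia.
      by left; have := tri (h m q x) q q'; rewrite (dC (h m q x) q'); lia.
    + have [[? _]|far|[_ le]] := sites_dich st (ltnW gt') Qq' Qq; first lia.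
        by left; have := tri (h m q x) q' q; rewrite (dC (h m q x) q); lia.
      by right; have := tri q q' (h m q x); lia.
    + have [[? _]|far|[_ le]] := sites_dich st (ltnW lt) Qq Qq'; first lia.
        by left; have := tri (h m q x) q q'; rewrite (dC (h m q x) q'); lia.
      have [|v pv vE] := su q'; first lia.
      have pv' : d p v = d q q' by rewrite -vE (liso_dist L).
      have Qv : Q m' v by apply/(sites_coh st lt Qq); rewrite ?pv' ?vE.
      have := cl m' v Qv; rewrite -(dE v x) ?vE; lia.
have SG m : j.+1 <= m -> m <= N -> 2 * R j + S j <= S m by move=> jm _; apply: gS.
have [I [I1 I2 I3 I4 I5]] := maximal_separated hG st Rt SG eligi.
have Ip : I p.
  apply: I5; split; first by exists id; apply: liso_id.
  move=> m q Qq; have jm := Qj _ _ Qq; have [_ Qm] := sites_root st Qq.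
  have := gR jm.
  have [[_ <-]|far|[]] := sites_dich st (leqnn _) Qq Qm; last lia.
    by right; rewrite dxx; lia.
  by left; lia.
have S0 m : j.+1 <= m -> m <= N -> 0 <= S m by [].
have [ks [rp [ch [C1 C2 [C3 C4]]]]] := stage_charts sym con st Rt (k := j.+1) 0 S0.
(* every class has one chosen chart at its representative *)
have /choice[H0 H0P] : forall v, exists f, (repeats j v -> liso e (t j) p v f) /\ (v = p -> f = id).
  move=> v; have [vp|ne] := eqVneq v p; first by exists id; split=> // _; rewrite vp; apply: liso_id.
  have [[f Lf]|nr] := pselect (repeats j v).
    by exists f; split=> // vE; rewrite vE eqxx in ne.
  by exists id; split.
have IE x : I x -> I (rp x) /\ repeats j (rp x).
  move=> Ix; suff Ir : I (rp x) by split=> //; exact: (I1 _ Ir).1.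
  case: (C1 x) => [[[_ ->] _] //|[q [kx Qq pr rE _]]].
  by rewrite -(I4 _ q (rp x) kx Qq) // rE.
pose H x := ch x \o H0 (rp x).
exists I, H; split=> //; last by move=> x rx cx; apply: I3.
have QnI m : m < j -> forall q, ~ Q m q by move=> mj q /Qj; lia.
(* the chosen charts stay inside the representative's clear zone *)
have stay u z : I u -> ks u <= N -> d p z <= R j -> d p (H0 (rp u) z) <= R (ks u).
  move=> Iu kN pz; have [Ir rr] := IE u Iu.
  case: (C1 u) => [[[E _] _]|[q [kx Qq pr rE _]]]; first lia.
  have [_ cl] := I1 _ Ir; have [_ Qpk] := sites_root st Qq.
  have := cl _ _ Qpk; have := (H0P (rp u)).1 rr => Lr.
  have := tri (rp u) p (H0 (rp u) z).
  have := liso_dist Lr (u := z) (leq_trans pz (Rt j)); lia.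
split.
- move=> m q; case: eqP => [->|_]; first by [].
  move=> /[dup] Qq /(sites_root st)[mN Qm]; split=> //.
- move=> m m' q q' mm; case: eqP => [mE|mj]; case: eqP => [mE'|mj'].
  + move=> Iq Iq'; rewrite mE mE'; have [le|gt'] := leqP (d q q') (2 * R j + S j).
      by constructor 1; split=> //; apply: I2.
    by constructor 2; lia.
  + by move=> _ /Qj; lia.
  + move=> Qq Iq'; rewrite mE'; have [_ cl] := I1 _ Iq'; have := cl m q Qq; have := Qj _ _ Qq.
    by move=> jm [far|le]; [constructor 2; lia|constructor 3; lia].
  + exact: (sites_dich st mm).
- move=> m q; case: eqP => [->|_]; last exact: (sites_chart st).
  move=> Iq; have [Ir rr] := IE q Iq; have Lr := (H0P (rp q)).1 rr.
  rewrite /H; case: (C1 q) => [[[_ rE] ->]|[u [kx Qu pr rE ->]]]; first by rewrite rE in Lr *.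
  apply: (liso_comp Lr); rewrite -{2}rE; apply: (liso_restr con (sites_chart st Qu)).
  by have := gt kx; lia.
- move=> m m' q u mm; case: eqP => [mE|mj]; case: eqP => [mE'|mj'].
  + lia.
  + by move=> _ _; split=> /Qj; lia.
  + move=> Qq le; have jm := Qj _ _ Qq; rewrite (I4 m q) //; lia.
  + exact: (sites_coh st mm).
- move=> m m' q u z mm; case: eqP => [mE|mj]; case: eqP => [mE'|mj'].
  + lia.
  + by move=> _ _ /Qj; lia.
  + move=> Qq le Iu pz; subst m'; have jm := Qj _ _ Qq.
    have [mN _] := sites_root st Qq.
    have [km rE cE] := C2 m q u jm Qq ltac:(lia).
    by rewrite /H /= rE cE // stay //; lia.
  + exact: (sites_comp st mm).
- move=> m z; case: eqP => [->|_]; last exact: (sites_id st).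
  move=> _ pz; rewrite /H /= C3 (H0P p).2 //=.
  case: (C1 p) => [[_ ->] //|[q [kx _ _ _ _]]].
  by apply: C4; have := gt kx; lia.
Qed.

(** Sites are added from the top level N down to level 0. *)
Lemma sites_exist : exists Q h,
  [/\ sites Q h, forall m, m <= N -> Q m p
    & forall n x, n <= N -> repeats n x -> clear (fun m q => n < m /\ Q m q) n x ->
        exists2 q, Q n q & d x q <= 2 * R n + S n].
Proof.
suff main i : i <= N.+1 -> exists Q h,
  [/\ sites Q h, forall m q, Q m q -> N.+1 - i <= m, forall m, N.+1 - i <= m -> m <= N -> Q m p
    & forall n x, N.+1 - i <= n -> n <= N -> repeats n x ->
        clear (fun m q => n < m /\ Q m q) n x ->
        exists2 q, Q n q & d x q <= 2 * R n + S n].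
  have [Q [h [st _ Qp mx]]] := main N.+1 (leqnn _); exists Q, h; split=> //.
    by move=> m; apply: Qp; rewrite subnn.
  by move=> n x; apply: mx; rewrite subnn.
elim: i => [_|i IH iN].
  exists (fun _ _ => False), (fun _ _ => id); split; [by split|by []|by move=> m; lia|by move=> n x; lia].
have [Q [h [st Qi Qp mx]]] := IH ltac:(lia).
pose j := N - i.
have Qj m q : Q m q -> j < m by move=> /Qi; rewrite /j; lia.
have Qp' m : j < m -> m <= N -> Q m p by move=> jm mN; apply: Qp => //; rewrite /j in jm; lia.
have [I [H [st' Ip mxI]]] := add_sites (leq_subr _ _ : j <= N) st Qj Qp'.
do 2 eexists; split; first exact: st'.
- by move=> m q /=; case: eqP => [->|_ /Qi]; rewrite /j; lia.
- by move=> m jm mN /=; case: eqP => // ne; apply: Qp => //; rewrite /j in ne; lia.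
move=> n x jn nN rn cl /=.
have [nj|nj] := eqVneq n j.
  subst n; apply: mxI => // m q Qq; have jm := Qj _ _ Qq.
  by apply: (cl m q); split=> //; case: eqP => //; lia.
apply: mx => //; first by rewrite /j in nj; lia.
move=> m q [nm Qq]; apply: (cl m q); split=> //; case: eqP => // mj; rewrite /j in mj nj; lia.
Qed.

(** If no site of level above n cuts z, that is, has its boundary near z, then a
repetition near z is clear and a site of level n is near.  Otherwise z is moved inwards.
The sites that cut the new point are nested in the site that did cut z, with a margin
S m that has to be at most 2b, so their level m is at most 2b.  From then on the levels
decrease, and the number of moves is bounded independently of N. *)
Lemma sites_dense (Q : nat -> X -> Prop) (h : nat -> X -> X -> X) n om :
  (forall m, m <= S m) -> sites Q h -> (forall m, m <= N -> Q m p) ->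
  (forall x, repeats n x -> clear (fun m q => n < m /\ Q m q) n x ->
     exists2 q, Q n q & d x q <= 2 * R n + S n) ->
  n <= N -> (forall x, exists2 v, repeats n v & d x v <= om) ->
  forall x, exists2 q, Q n q &
    d x q <= 2 * (R n + S n + om) * (2 * (R n + S n + om) + 3) + om + 2 * R n + S n.
Proof.
move=> Sm st Qp mx nN dense x; pose b := R n + S n + om; rewrite -/b.
pose cut m q z := [/\ n < m, Q m q, R m < d q z + b & d q z <= R m + b].
have Qn m q : n < m -> Q m q -> Q n q.
  move=> nm Qq; have [mN Qm] := sites_root st Qq.
  rewrite -[q](_ : h m q p = q); last by have [] := sites_chart st Qq.
  have le : d p p + R n + S n <= R m by rewrite dxx; have := gR nm; lia.
  exact: (sites_coh st nm Qq le).1 (Qp n nN).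
have free z : (forall m q, ~ cut m q z) -> exists2 q, Q n q & d z q <= om + (2 * R n + S n).
  move=> nc; have [v rv zv] := dense z; have [|q Qq vq] := mx v rv.
    move=> m q [nm Qq]; have := nc m q.
    have [le|gt1] := leqP (d q z + b) (R m).
      by have := tri z q v => ? _; right; rewrite /b in le; lia.
    have [le|gt2] := leqP (d q z) (R m + b); first by case; split.
    by have := tri v q z; rewrite (dC v z) => ? _; left; rewrite /b in gt2; lia.
  by exists q => //; have := tri v z q; lia.
(* inside a site that cuts z, just below its boundary, only smaller sites cut *)
have inward m q z : cut m q z -> (exists2 q, Q n q & d z q <= 2 * b) \/
    exists2 z', d z z' <= 2 * b & forall m1 q1, cut m1 q1 z' -> m1 < m /\ m1 <= 2 * b.
  move=> [nm Qq lo hi]; have [small|big] := ltnP (R m) b.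
    by left; exists q; [apply: Qn Qq|rewrite dC; lia].
  have [z' qz' z'z] := @gdist_between _ _ con q z (R m - b) ltac:(lia).
  right; exists z'; first by rewrite dC; lia.
  move=> m1 q1 [nm1 Qq1 lo1 hi1].
  have [lt|gt1|eq] := ltngtP m1 m; last first.
  - subst m1; have [[_ qE]|far|[]] := sites_dich st (leqnn _) Qq Qq1; last lia.
      by rewrite -qE in lo1 hi1; lia.
    by have := tri z' q q1; rewrite (dC z' q1); lia.
  - have [[? _]|far|[_ le]] := sites_dich st (ltnW gt1) Qq1 Qq; first lia.
      by have := tri z' q1 q; rewrite (dC z' q); lia.
    by have := tri q q1 z'; have := gS nm; rewrite /b in lo1 big qz'; lia.
  - split=> //; have [[? _]|far|[_ le]] := sites_dich st (ltnW lt) Qq Qq1; first lia.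
      by have := tri z' q q1; rewrite (dC z' q1); have := gS nm1; rewrite /b in hi1; lia.
    by have := tri q1 q z'; have := Sm m1; lia.
have descend L : forall z, (forall m q, cut m q z -> m < L) ->
    exists2 q, Q n q & d z q <= 2 * b * L + (om + (2 * R n + S n)) + 2 * b.
  elim: L => [|L IH] z small.
    have [|q Qq zq] := free z; first by move=> m q /small.
    by exists q => //; lia.
  have [[m [q cmq]]|nc] := pselect (exists m q, cut m q z); last first.
    have [|q Qq zq] := free z; first by move=> m q c; apply: nc; exists m, q.
    by exists q => //; lia.
  have [[q1 Qq1 zq1]|[z' zz' sm]] := inward _ _ _ cmq; first by exists q1 => //; lia.
  have [|q1 Qq1 zq1] := IH z'.
    by move=> m1 q1 /sm[lt _]; have := small _ _ cmq; lia.
  exists q1 => //; have := tri z' z q1; rewrite mulnS; lia.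
have [[m [q cmq]]|nc] := pselect (exists m q, cut m q x); last first.
  have [|q Qq xq] := free x; first by move=> m q c; apply: nc; exists m, q.
  by exists q => //; lia.
have [[q1 Qq1 xq1]|[z' xz' sm]] := inward _ _ _ cmq.
  by exists q1 => //; rewrite mulnDr; lia.
have [|q1 Qq1 zq1] := descend (2 * b + 1) z'.
  by move=> m1 q1 /sm[_ le]; lia.
exists q1 => //; have := tri z' x q1; lia.
Qed.
End Repetition.

(** * Both parts of the theorem *)

Section Conclusion.
Variables (X : countType) (e : rel X) (Delta : nat).
Hypothesis hG : infinite_simple_graph e Delta.
Let sym : symmetric e. Proof. by case: hG. Qed.
Let irr : irreflexive e. Proof. by case: hG. Qed.
Let con : connected_graph e. Proof. by case: hG. Qed.
Local Notation d := (gdist e).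

Lemma liso_bij r x y f : liso e r x y f -> set_bij (gball e x r) (gball e y r) f.
Proof.
move=> L; have [_ _ su] := L; split=> [u xu|u v|v yv]; rewrite /gball /=.
- by rewrite (liso_dist L).
- by rewrite !inE => xu xv; apply: (liso_inj con L).
- by have [u xu <-] := su v yv; exists u.
Qed.

Lemma ciso_same_ball (C : Type) r x y f (phi : X -> C) :
  ciso e r x y f phi phi -> same_colored_ball e r phi x y.
Proof.
move=> [L co]; have [fx _ _] := L; exists f; split=> //; first exact: liso_bij.
by move=> u v xu xv; apply: (liso_adj irr con L).
Qed.

Lemma same_metric_ball_liso r x y : same_metric_ball e r x y -> exists f, liso e r x y f.
Proof.
move=> [f [[_ _ su] fx dE]]; exists f; split=> // v yv.
Qed.

Lemma same_metric_ball_le r r' x y : same_metric_ball e r x y -> r' <= r ->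
  same_metric_ball e r' x y.
Proof.
move=> /same_metric_ball_liso[f L] /(liso_le con L){}L; have [fx dE _] := L.
by exists f; split=> //; apply: liso_bij.
Qed.

Lemma separates_distinguishes eps (phi : X -> 'I_Delta) j x y :
  separates eps e phi j -> 0 < d x y < eps j ->
  ~ same_colored_ball e (3 * sc_iso (scales Delta eps j)) phi x y.
Proof.
move=> sep /andP[xy0 xy] /(same_ball_ciso sym irr con)[f ff].
have xE : x = y by apply: (sep _ _ _ ff); rewrite /eps3; lia.
by move: xy0; rewrite xE gdistxx.
Qed.

(** The levels built over the empty family of sites give part (i). *)
Lemma aperiodic_coloring eps N : exists phi : X -> 'I_Delta,
  forall j, j <= N -> separates eps e phi j.
Proof.
have [p _] : exists p : X, True.
  apply: contrapT => nX; case: hG => _ _ _ + _; apply.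
  by apply: (@sub_finite_set _ _ set0) => // x _; apply: nX; exists x.
have st : sites e N (fun m => sc_R (scales Delta eps m)) (fun m => sc_S (scales Delta eps m))
  (fun m => sc_t (scales Delta eps m)) p (fun _ _ => False) (fun _ _ => id) by split.
have [B [Phi [_ sep]]] := levels hG st N.
by exists (Phi (fun _ => None)); apply: sep.
Qed.

Definition repetition_radius eps n om :=
  let c := scales Delta eps n in
  2 * (sc_R c + sc_S c + om) * (2 * (sc_R c + sc_S c + om) + 3) + om + 2 * sc_R c + sc_S c.

(** The bound is uniform in om, so that the coloring does not depend on it. *)
Lemma repetitive_coloring p eps N : exists phi : X -> 'I_Delta,
  (forall j, j <= N -> separates eps e phi j) /\
  forall n om, n <= N ->
    relatively_dense e om [set x | same_metric_ball e (sc_t (scales Delta eps n)) x p] ->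
    relatively_dense e (repetition_radius eps n om)
      [set x | same_colored_ball e (sc_sum (scales Delta eps n)) phi x p].
Proof.
pose R m := sc_R (scales Delta eps m). pose S m := sc_S (scales Delta eps m).
pose t m := sc_t (scales Delta eps m).
have gR j m : j < m -> R j + S j <= R m by case/(scale_growth Delta eps).
have gS j m : j < m -> 2 * R j + S j <= S m by case/(scale_growth Delta eps).
have gt j m : j < m -> R m + t j <= t m by case/(scale_growth Delta eps).
have Rt m : R m <= t m by have := @scale_t Delta eps 0 m 0 (leq0n m) (leq0n _); rewrite addn0.
have [Q [h [st Qp mx]]] := sites_exist hG N p gR gS gt Rt.
have [B [Phi [hL sep]]] := levels hG st N.
exists (Phi (fun _ => None)); split; first exact: sep.
move=> n om nN dense x.
have dense' y : exists2 v, repeats e t p n v & d y v <= om.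
  have [v vp yv] := dense y; exists v => //.
  have [f Lf] := same_metric_ball_liso vp.
  by have [g [Lg _ _]] := liso_inv con Lf; exists g.
have [q Qq xq] := sites_dense hG gR gS (@scale_S_ge Delta eps) st Qp
  (fun x => mx n x nN) nN dense' x.
exists q => //=.
have le : sc_sum (scales Delta eps n) <= t n.
  by have := Rt n; rewrite /R scalesE /=; lia.
have c1 : ciso e (sc_sum (scales Delta eps n)) p q (h n q) (Phi (fun _ => None)) (Phi (fun _ => None)).
  split; first exact: (liso_le con (sites_chart st Qq) le).
  by move=> u pu; apply: (lv_froz hL).
by have [g [cg _ _]] := ciso_inv con c1; apply: ciso_same_ball cg.
Qed.
End Conclusion.

Lemma nth_upto u n i : i <= n -> nth 0 (upto u n) i = u i.
Proof. by move=> le; rewrite nth_mkseq. Qed.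

Lemma size_upto u n : (size (upto u n)).-1 = n.
Proof. by rewrite size_mkseq. Qed.

Lemma scales_upto Delta eps N n : n <= N ->
  scales Delta (nth 0 (upto eps N)) n = scales Delta eps n.
Proof. by move=> nN; apply: eq_scales => i le; rewrite nth_upto //; apply: leq_trans nN. Qed.

Lemma separates_upto Delta (X : countType) (e : rel X) (phi : X -> 'I_Delta) eps N j : j <= N ->
  separates (nth 0 (upto eps N)) e phi j -> separates eps e phi j.
Proof.
by move=> jN sep x y f; have := sep x y f; rewrite /eps3 scales_upto // nth_upto.
Qed.

Theorem theorem2p17 :
  (* (i) *)
  (exists deltaF : nat -> seq nat -> seq nat -> nat,
     forall (X : countType) (e : rel X) (Delta : nat),
       infinite_simple_graph e Delta ->
     exists phiF : seq nat -> X -> 'I_Delta,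
     forall eps : nat -> nat,
       positive_seq eps -> increases_to_infinity eps ->
     exists (delta : nat -> nat) (phi : nat -> X -> 'I_Delta),
       [/\ positive_seq delta,
           forall n, delta n = deltaF Delta (upto eps n) (below delta n),
           forall N, phi N = phiF (upto eps N)
         & distinguishes e eps delta phi])
  /\
  (* (ii) *)
  (exists (threshold : nat -> seq nat -> nat)
          (rF : nat -> seq nat -> seq nat -> seq nat -> nat)
          (alphaF : nat -> seq nat -> seq nat -> seq nat -> seq nat -> nat)
          (deltaF : nat -> seq nat -> seq nat -> nat),
     forall (X : countType) (e : rel X) (Delta : nat),
       infinite_simple_graph e Delta ->
     forall p : X,
     exists phiF : seq nat -> seq nat -> X -> 'I_Delta,
     forall eps rho omega : nat -> nat,
       positive_seq eps -> increases_to_infinity eps ->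
       positive_seq rho -> increases_to_infinity rho ->
       positive_seq omega ->
       (forall n, threshold Delta (upto eps n) < rho n) ->
       (forall n, relatively_dense e (omega n)
                    [set x | same_metric_ball e (rho n) x p]) ->
     exists (r alpha delta : nat -> nat) (phi : nat -> X -> 'I_Delta),
       [/\ [/\ positive_seq r, increases_to_infinity r
             & forall n, r n =
                 rF Delta (upto eps n) (upto omega n) (below r n)],
           positive_seq alpha /\
           (forall n, alpha n =
              alphaF Delta (upto eps n) (upto omega n)
                     (below r n) (below alpha n)),
           forall N, phi N = phiF (upto eps N) (upto rho N),
           [/\ positive_seq delta,
               forall n, delta n = deltaF Delta (upto eps n) (below delta n)
             & distinguishes e eps delta phi]
         & forall N n, n <= N ->
             relatively_dense e (alpha n)
               [set x | same_colored_ball e (\sum_(i < n.+1) r i)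
                          (phi N) x p]]).
Proof.
pose scale_of Delta l := scales Delta (nth 0 l) (size l).-1.
have scale_ofE Delta eps n : scale_of Delta (upto eps n) = scales Delta eps n.
  by rewrite /scale_of size_upto scales_upto.
pose deltaF Delta l (_ : seq nat) := 3 * sc_iso (scale_of Delta l).
have delta_gt0 Delta eps n : 0 < 3 * sc_iso (scales Delta eps n).
  by have := sc_iso_ge Delta eps n.+1 => /=; lia.
split.
  exists deltaF => X e Delta hG.
  pose phiF l := projT1 (cid (aperiodic_coloring hG (nth 0 l) (size l).-1)).
  exists phiF => eps eps0 epsI.
  exists (fun n => 3 * sc_iso (scales Delta eps n)), (fun N => phiF (upto eps N)).
  split=> // [n|x y N n nN]; first by rewrite /deltaF scale_ofE.
  apply: (separates_distinguishes hG); apply: (separates_upto nN).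
  by rewrite /phiF; case: cid => phi sep; apply: sep; rewrite size_upto.
exists (fun Delta l => sc_t (scale_of Delta l)).
exists (fun Delta l _ _ => sc_r (scale_of Delta l)).
(* the successor makes alpha positive *)
exists (fun Delta l w _ _ => (repetition_radius Delta (nth 0 l) (size l).-1 (nth 0 w (size w).-1)).+1).
exists deltaF => X e Delta hG p.
pose phiF l (_ : seq nat) := projT1 (cid (repetitive_coloring hG p (nth 0 l) (size l).-1)).
exists phiF => eps rho omega eps0 epsI rho0 rhoI om0 thr dense.
exists (fun n => sc_r (scales Delta eps n)).
exists (fun n => (repetition_radius Delta eps n (omega n)).+1).
exists (fun n => 3 * sc_iso (scales Delta eps n)), (fun N => phiF (upto eps N) (upto rho N)).
have phiP N : (forall j, j <= N -> separates eps e (phiF (upto eps N) (upto rho N)) j) /\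
    forall n om, n <= N ->
      relatively_dense e om [set x | same_metric_ball e (sc_t (scales Delta eps n)) x p] ->
      relatively_dense e (repetition_radius Delta eps n om)
        [set x | same_colored_ball e (sc_sum (scales Delta eps n))
                   (phiF (upto eps N) (upto rho N)) x p].
  have := projT2 (cid (repetitive_coloring hG p (nth 0 (upto eps N)) (size (upto eps N)).-1)).
  rewrite -/(phiF (upto eps N) (upto rho N)); move: (phiF _ _) => phi.
  rewrite size_upto => -[sep rep].
  split=> [j jN|n om nN]; first by apply: (separates_upto jN); apply: sep.
  by have := rep n om nN; rewrite /repetition_radius !scales_upto.
split=> //.
- split=> [n||n]; last by rewrite scale_ofE.
    by have := sc_r_ge Delta eps n; lia.
  split; first by move=> m n; apply: sc_r_mono.
  move=> A [M _ MA]; exists M => // n /= Mn; apply: MA => /=.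
  by have := sc_r_ge Delta eps n; lia.
- split=> // n; rewrite !size_upto nth_upto // /repetition_radius.
  by rewrite scales_upto.
- split=> // [n|x y N n nN]; first by rewrite /deltaF scale_ofE.
  by apply: (separates_distinguishes hG); have [sep _] := phiP N; apply: sep.
move=> N n nN x; have [_ /(_ n (omega n) nN) rep] := phiP N.
have [|q qP xq] := rep _ x; last first.
  by exists q; [move: qP; rewrite /= sc_sumE|apply: leqW].
move=> y; have [v vp yv] := dense n y; exists v => //=.
by apply: (same_metric_ball_le hG vp); apply: ltnW; rewrite -scale_ofE.
Qed.
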